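(* Let $0<\alpha\leq 1$, $a,b,c\in\mathbb{R}$, and consider the fractional initial value problem $$\,_0^{C}D_t^{\alpha}[x](t)=a x^3(t)+b x^2(t)+c x(t),\qquad x(0)=x_0.$$ (A) Suppose $a\neq 0$. (A1) The equilibrium point $x_1=0$ is locally unstable if $c>0$ and locally asymptotically stable if $c<0$. Suppose moreover that $b^2-4ac>0$, and let $$x_2=\frac{-b+\sqrt{b^2-4ac}}{2a},\qquad x_3=\frac{-b-\sqrt{b^2-4ac}}{2a},$$ which are equilibrium points. (A2) If $a>0$, then $x_2$ is locally unstable when $b<\sqrt{b^2-4ac}$ and locally asymptotically stable when $b>\sqrt{b^2-4ac}$. If $a<0$, then $x_2$ is locally asymptotically stable when $b<\sqrt{b^2-4ac}$ and locally unstable when $b>\sqrt{b^2-4ac}$. (A3) If $a>0$, then $x_3$ is locally asymptotically stable when $b<-\sqrt{b^2-4ac}$ and locally unstable when $b>-\sqrt{b^2-4ac}$. If $a<0$, then $x_3$ is locally unstable when $b<-\sqrt{b^2-4ac}$ and locally asymptotically stable when $b>-\sqrt{b^2-4ac}$. (B) Suppose $a=0$, $b\neq 0$ and $c\neq 0$. The equilibrium points are $x_1=0$ and $x_2=-\frac{c}{b}$. If $c>0$, then $x_1$ is locally unstable and $x_2$ is locally asymptotically stable. If $c<0$, then $x_1$ is locally asymptotically stable and $x_2$ is locally unstable.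
   Context: For $0<\alpha\le 1$ the Caputo fractional derivative of order $\alpha$ is $\,_{0}^{C}D_{t}^{\alpha}[x](t)=\,_{0}I_{t}^{1-\alpha}[x'](t)$, where $\,_{0}I_{t}^{\beta}[g](t)=\frac{1}{\Gamma(\beta)}\int_0^t (t-s)^{\beta-1}g(s)\,ds$ for $\beta>0$ and $\,_{0}I_{t}^{0}$ is the identity. An equilibrium point of $\,_0^{C}D_t^{\alpha}[x](t)=f(x(t))$ is a real number $x_{eq}$ with $f(x_{eq})=0$. Local stability is in the usual Lyapunov sense for the initial value problem starting at $t=0$: $x_{eq}$ is locally stable if for every $\varepsilon>0$ there is $\delta>0$ such that every solution with $|x(0)-x_{eq}|<\delta$ exists for all $t\ge 0$ and satisfies $|x(t)-x_{eq}|<\varepsilon$ for all $t\geq 0$; it is locally asymptotically stable if it is locally stable and, in addition, there is $\delta_0>0$ such that $x(t)\to x_{eq}$ as $t\to\infty$ whenever $|x(0)-x_{eq}|<\delta_0$; it is locally unstable if it is not locally stable. *)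

(* Defs.v *)
From HB Require Import structures.
From mathcomp Require Import all_boot all_order all_algebra.
From mathcomp Require Import all_classical all_reals all_analysis.

Set Implicit Arguments.
Unset Strict Implicit.
Unset Printing Implicit Defensive.

Import Order.TTheory GRing.Theory Num.Theory.
Import numFieldNormedType.Exports.

Local Open Scope classical_set_scope.
Local Open Scope ring_scope.

(* Meaningful for z > 0 only: otherwise the integral diverges and its real
   value is a default one. *)
Definition Gamma {R : realType} (z : R) : R :=
  \int[lebesgue_measure]_(s in `]0, +oo[) (s `^ (z - 1) * expR (- s)).

Definition frac_int {R : realType} (beta : R) (g : R -> R) (t : R) : R :=
  if beta == 0 then g t
  else (Gamma beta)^-1 *
       \int[lebesgue_measure]_(s in `[0, t]) ((t - s) `^ (beta - 1) * g s).

(* The value of the two-sided derivative x^`() at 0 is irrelevant for t > 0: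
   it enters only through an integral, or not at all when alpha = 1. *)
Definition caputo {R : realType} (alpha : R) (x : R -> R) (t : R) : R :=
  frac_int (1 - alpha) x^`()%classic t.

(* Solutions on [0, T[, where 0 < T <= +oo; the values of x outside [0, T[ play
   no role.  For alpha < 1 a nonconstant solution behaves like
   x 0 + k * t `^ alpha near 0, so x' is only required to exist and be
   continuous for t > 0 and to be integrable near 0; the integral defining the
   Caputo derivative then converges absolutely at every t in ]0, T[.  At t = 0
   that integral is over a null set, so the equation is imposed for t > 0. *)
Definition caputo_solution {R : realType} (alpha : R) (f : R -> R)
    (T : \bar R) (x : R -> R) : Prop :=
  [/\ (0 < T)%E,
      {within [set t : R | 0 <= t /\ (t%:E < T)%E], continuous x},
      (forall t : R, 0 < t -> (t%:E < T)%E ->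
         derivable x t 1 /\ {for t, continuous x^`()%classic}),
      (forall t : R, 0 < t -> (t%:E < T)%E ->
         lebesgue_measure.-integrable `]0, t[ (EFin \o x^`()%classic)) &
      (forall t : R, 0 < t -> (t%:E < T)%E -> caputo alpha x t = f (x t))].

(* y is a solution on [0, +oo[ extending the solution x on [0, T[; when
   T = +oo, this forces y = x on [0, +oo[. *)
Definition global_extension {R : realType} (alpha : R) (f : R -> R)
    (T : \bar R) (x y : R -> R) : Prop :=
  caputo_solution alpha f +oo%E y /\
  (forall t : R, 0 <= t -> (t%:E < T)%E -> y t = x t).

Definition equilibrium {R : realType} (f : R -> R) (xeq : R) : Prop :=
  f xeq = 0.

(* "Every solution exists for all t >= 0" is rendered as: every solution on an
   interval [0, T[ is the restriction of a solution on [0, +oo[, so that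
   finite-time blow-up contradicts stability. *)
Definition locally_stable {R : realType} (alpha : R) (f : R -> R) (xeq : R)
    : Prop :=
  forall e : R, 0 < e -> exists2 d : R, 0 < d &
    forall (T : \bar R) (x : R -> R),
      caputo_solution alpha f T x -> `|x 0 - xeq| < d ->
      exists2 y : R -> R, global_extension alpha f T x y &
        forall t : R, 0 <= t -> `|y t - xeq| < e.

Definition locally_asymptotically_stable {R : realType} (alpha : R)
    (f : R -> R) (xeq : R) : Prop :=
  locally_stable alpha f xeq /\
  exists2 d0 : R, 0 < d0 &
    forall (T : \bar R) (x : R -> R),
      caputo_solution alpha f T x -> `|x 0 - xeq| < d0 ->
      exists2 y : R -> R, global_extension alpha f T x y &
        y t @[t --> +oo] --> xeq.

Definition locally_unstable {R : realType} (alpha : R) (f : R -> R) (xeq : R)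
    : Prop :=
  ~ locally_stable alpha f xeq.

Definition cubic {R : realType} (a b c x : R) : R :=
  a * x ^+ 3 + b * x ^+ 2 + c * x.

(* Main.v *)
Require Import Defs.
From HB Require Import structures.
From mathcomp Require Import all_boot all_order all_algebra.
From mathcomp Require Import all_classical all_reals all_analysis.
From mathcomp Require Import measurable_realfun ring lra.
Set Implicit Arguments.
Unset Strict Implicit.
Unset Printing Implicit Defensive.
Import Order.TTheory GRing.Theory Num.Theory.
Import numFieldNormedType.Exports.
Local Open Scope classical_set_scope.
Local Open Scope ring_scope.

(** An equilibrium q of a cubic f is moved to the origin by a translation, which
    turns f into another cubic, with linear coefficient f'(q) ([cubic_shift]).  So
    the theorem says that the origin is asymptotically stable when that coefficient
    is negative ([cubic_asymptotically_stable]) and unstable when it is positive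
    ([cubic_unstable]); the case distinctions on a, b and the discriminant only
    compute the sign of f'(q) ([cubic_deriv_root]).

    Both halves rest on the extremum principle [caputo_touch]: if x - y, looked at
    on ]0, t], is largest at t, then the Caputo derivative of x at t is at least
    that of y.  Integration by parts shows it, because the kernel increases and
    the boundary term at t vanishes.  For a negative linear coefficient, f is
    strictly decreasing near the origin, and the principle gives a comparison
    lemma for sub- and supersolutions ([comparison]).  Compared with
    constants, solutions stay within their initial distance of the origin
    ([bounded_by_initial]); compared with one another, they are determined by
    their initial value; compared with eta + m / (1 + rho p(t)), where p is a
    multiple of t `^ alpha and has constant Caputo derivative, they end up below
    2 eta ([cubic_decay]).  For a positive linear coefficient, a solution that
    starts at x0 > 0 and stays small cannot touch from above the unbounded barrier
    x0 / 2 + rho p(t), again by the extremum principle.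

    Solutions must also be produced: by uniqueness, a solution on [0, T[ extends
    as soon as some global solution has its initial value, and instability needs
    at least one solution near the origin.  Since the derivative is part of the
    definition, it is the unknown: differentiating the Volterra equation and
    writing y'(t) = t `^ (alpha - 1) w(t) gives an equation for a continuous w, in
    which f' is replaced by a bounded Lipschitz function h that agrees with f' near
    the origin.  Picard iteration solves it on the whole half-line
    ([picard_solution]).  Abel's identity ([abel_scaled]) leads back to the Caputo
    equation, valid at t as long as y stays in the region where h = f' on [0, t]
    ([clamped_solution]); there the chain rule turns the integral of h(y) y' into
    f(y) - f(y 0). *)

Local Notation mu := (@lebesgue_measure _).

(** * Calculus for the Lebesgue integral on the line *)

Lemma integral_smooth_FTC2 (R : realType) (f F : R -> R) (a b : R) :
  a < b -> (forall x, a <= x <= b -> is_derive x 1 F (f x)) ->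
  (forall x, a <= x <= b -> {for x, continuous f}) ->
  (\int[lebesgue_measure]_(x in `[a, b]) (f x)%:E = (F b - F a)%:E)%E.
Proof.
move=> ab dF cf.
have cF x : a <= x <= b -> {for x, continuous F}.
  move=> /dF hx; apply/differentiable_continuous/derivable1_diffP.
  exact: ex_derive.
rewrite (@continuous_FTC2 _ f F a b)//.
- apply: continuous_in_subspaceT => x /set_mem/=; rewrite in_itv/= => /cf.
  exact.
- split.
  + by move=> x; rewrite in_itv/= => /andP[ax xb]; have := dF x; rewrite !ltW// => /(_ isT).
  + by apply: cvg_at_right_filter; apply: cF; rewrite lexx ltW.
  + by apply: cvg_at_left_filter; apply: cF; rewrite lexx ltW.
- move=> x; rewrite in_itv/= => /andP[ax xb].
  rewrite derive1E; apply: derive_val; apply: dF; rewrite !ltW//.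
Qed.

Lemma affine_measurable (R : realType) (r a : R) (D : set R) :
  measurable_fun D (fun u : R => r + a * u).
Proof. by apply: measurable_funD => //; exact: measurable_funM. Qed.

Lemma lebesgue_measure_itv_side (R : realType) (b1 b2 : bool) (x y : R) :
  lebesgue_measure [set` Interval (BSide b1 x) (BSide b2 y)]%classic =
    (if (x < y)%R then (y - x)%:E else 0)%E.
Proof. by rewrite lebesgue_measure_itv/= lte_fin. Qed.

(** The measure `|a| times the image of Lebesgue measure under the affine map
    gives every half-open interval its length, hence is Lebesgue measure. *)
Lemma ge0_integral_affine (R : realType) (r a : R) (D : set R) (G : R -> \bar R) :
  a != 0 -> measurable D -> measurable_fun D G -> (forall x, D x -> 0 <= G x)%E ->
  (\int[lebesgue_measure]_(s in D) G s =
   `|a|%:E * \int[lebesgue_measure]_(u in (fun u => r + a * u)%R @^-1` D) G (r + a * u)%R)%E.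
Proof.
move=> a0 mD mG G0.
have mphi : measurable_fun [set: measurableTypeR R]
  ((fun u => r + a * u) : measurableTypeR R -> measurableTypeR R) by exact: affine_measurable.
have na0 : 0 < `|a| by rewrite normr_gt0.
pose k : {nonneg R} := NngNum (ltW na0).
pose phi u : R := r + a * u.
pose nu := mscale k (pushforward (@lebesgue_measure R) (phi : measurableTypeR R -> measurableTypeR R)).
have H : forall A : set (measurableTypeR R), measurable A -> lebesgue_measure A = nu mphi A.
  apply: lebesgue_measure_unique => _ [[x y] /= _ <-].
  rewrite /nu /mscale/= /pushforward.
  have [a_lt0|a_gt0|aE] := ltrgtP a 0; last by rewrite aE eqxx in a0.
  - rewrite (_ : phi @^-1` _ = `[(y - r) / a, (x - r) / a[%classic); last first.
      apply/seteqP; split => u /=; rewrite !in_itv/= => /andP[].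
        by rewrite ler_ndivrMr// ltr_ndivlMr// /phi => ? ?; apply/andP; split; lra.
      by rewrite ler_ndivrMr// ltr_ndivlMr// /phi => ? ?; apply/andP; split; lra.
    rewrite !lebesgue_measure_itv_side ltr_nM2r ?invr_lt0// ltrD2r ltr0_norm//.
    by case: ifP => _; rewrite ?mule0// -EFinM; congr (_%:E); field; rewrite lt_eqF.
  - rewrite (_ : phi @^-1` _ = `](x - r) / a, (y - r) / a]%classic); last first.
      apply/seteqP; split => u /=; rewrite !in_itv/= => /andP[].
        by rewrite ler_pdivlMr// ltr_pdivrMr// /phi => ? ?; apply/andP; split; lra.
      by rewrite ler_pdivlMr// ltr_pdivrMr// /phi => ? ?; apply/andP; split; lra.
    rewrite !lebesgue_measure_itv_side ltr_pM2r ?invr_gt0// ltrD2r gtr0_norm//.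
    by case: ifP => _; rewrite ?mule0// -EFinM; congr (_%:E); field; rewrite gt_eqF.
rewrite (eq_measure_integral (nu mphi)); last by move=> A mA _; exact: H.
rewrite /nu ge0_integral_mscale//=; congr (_ * _)%E.
rewrite ge0_integral_pushforward//.
by move=> y /set_mem; exact: G0.
Qed.

(** * Integrability of power and beta kernels *)

Lemma is_derive_continuous (R : realType) (f : R -> R) (x df : R) :
  is_derive x 1 f df -> {for x, continuous f}.
Proof.
move=> h; apply/differentiable_continuous/derivable1_diffP.
exact: ex_derive.
Qed.

Lemma continuous_powR_gt0 (R : realType) (p x : R) : 0 < x ->
  {for x, continuous (fun y => y `^ p)}.
Proof. by move=> x0; apply/is_derive_continuous/is_derive1_powR. Qed.

Lemma continuous_comp_powR (R : realType) (f : R -> R) (p x : R) : 0 < f x ->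
  {for x, continuous f} -> {for x, continuous (fun y => f y `^ p)}.
Proof.
move=> fx0 cf; apply: (@continuous_comp _ _ _ f (fun y => y `^ p)) => //.
exact: continuous_powR_gt0.
Qed.

Lemma measurable_powR_comp (R : realType) (D : set R) (f : R -> R) (p : R) :
  measurable_fun D f -> measurable_fun D (fun x => f x `^ p).
Proof. by move=> mf; apply: (@measurableT_comp _ _ _ _ _ _ (fun y : R => y `^ p)) => //; exact: measurable_powR. Qed.

Lemma measurable_fun_continuousT (R : realType) (D : set R) (f : R -> R) :
  continuous f -> measurable D -> measurable_fun D f.
Proof.
by move=> cf mD; apply: measurable_funTS; exact: continuous_measurable_fun.
Qed.

Lemma Lintegrable_le (R : realType) (D : set R) (f g : R -> R) :
  measurable D -> measurable_fun D f -> (forall x, D x -> `|f x| <= g x) ->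
  mu.-integrable D (EFin \o g) -> mu.-integrable D (EFin \o f).
Proof.
move=> mD mf fg; apply: le_integrable => //; first exact/measurable_EFinP.
move=> x Dx /=; rewrite lee_fin (le_trans (fg x Dx))//; exact: ler_norm.
Qed.

Lemma LintegrableD (R : realType) (D : set R) (f g : R -> R) : measurable D ->
  mu.-integrable D (EFin \o f) -> mu.-integrable D (EFin \o g) ->
  mu.-integrable D (EFin \o (fun x => f x + g x)).
Proof. by move=> mD fi gi; have := @integrableD _ _ _ (@lebesgue_measure R) D mD _ _ fi gi. Qed.

Lemma LintegrableB (R : realType) (D : set R) (f g : R -> R) : measurable D ->
  mu.-integrable D (EFin \o f) -> mu.-integrable D (EFin \o g) ->
  mu.-integrable D (EFin \o (fun x => f x - g x)).
Proof. by move=> mD fi gi; have := @integrableB _ _ _ (@lebesgue_measure R) D mD _ _ fi gi. Qed.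

Lemma LintegrableZ (R : realType) (D : set R) (c : R) (f : R -> R) : measurable D ->
  mu.-integrable D (EFin \o f) ->
  mu.-integrable D (EFin \o (fun x => c * f x)).
Proof. by move=> mD fi; have := @integrableZl _ _ _ (@lebesgue_measure R) D mD c _ fi. Qed.

Lemma LintegrableM_bounded (R : realType) (D : set R) (k f : R -> R) (C : R) :
  measurable D -> measurable_fun D f -> (forall x, D x -> `|f x| <= C) ->
  mu.-integrable D (EFin \o k) ->
  mu.-integrable D (EFin \o (fun x => k x * f x)).
Proof.
move=> mD mf fC ki.
apply: (@Lintegrable_le _ _ _ (fun x => C * `|k x|)) => //.
- by apply: measurable_funM => //; move/integrableP : ki => [/measurable_EFinP].
- by move=> x Dx; rewrite normrM mulrC ler_wpM2r// fC.
- by apply: LintegrableZ => //; exact: integrable_norm ki.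
Qed.

Lemma continuous_within_of (R : realType) (D : set R) (f : R -> R) :
  (forall x, D x -> {for x, continuous f}) -> {within D, continuous f}.
Proof. by move=> h; apply: continuous_in_subspaceT => x /set_mem/h. Qed.

Lemma Lintegrable_continuous (R : realType) (f : R -> R) (a b : R) :
  {within `[a, b], continuous f} -> mu.-integrable `[a, b] (EFin \o f).
Proof.
by move=> cf; apply: continuous_compact_integrable => //; exact: segment_compact.
Qed.

Lemma integrable_oo_cc (R : realType) (f : R -> R) (a b : R) :
  mu.-integrable `]a, b[ (EFin \o f) -> mu.-integrable `[a, b] (EFin \o f).
Proof.
move=> /integrableP[mf fi]; apply/integrableP; split.
  exact: emeasurable_fun_itv_cc mf.
by rewrite integral_itv_bndoo//; exact: measurableT_comp.
Qed.

(** The singular endpoint is approached along the intervals [1 / (n + 2), 1],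
    where the primitive u `^ q / q bounds the integral by 1 / q. *)
Lemma integrable_powR01 (R : realType) (q : R) : 0 < q ->
  mu.-integrable (`[0, 1] : set R) (EFin \o (fun u => u `^ (q - 1))).
Proof.
move=> q0; apply: integrable_oo_cc; apply/integrableP; split.
  by apply/measurable_EFinP; exact: measurable_powR_comp.
have mpow D : measurable_fun D (fun u : R => (u `^ (q - 1))%:E).
  by apply/measurable_EFinP; exact: measurable_powR_comp.
under eq_integral do rewrite /= ger0_norm ?powR_ge0//.
pose F (n : nat) : set R := `[n.+2%:R^-1, 1]%classic.
apply: (@le_lt_trans _ _ (q^-1)%:E); last exact: ltry.
apply: (@le_trans _ _ (\int[mu]_(x in \bigcup_n F n) (x `^ (q - 1))%:E)%E).
  apply: ge0_subset_integral => //.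
  - by apply: bigcup_measurable => n _; exact: measurable_itv.
  - exact: mpow.
  - by move=> x ?; rewrite lee_fin powR_ge0.
  - move=> x /=; rewrite in_itv/= => /andP[x0 x1].
    exists (Num.truncn x^-1) => //; rewrite /F/= in_itv/= (ltW x1) andbT.
    have := Num.Theory.truncnS_gt (x^-1) => /ltW h.
    rewrite -[leRHS]invrK lef_pV2 ?posrE ?ltr0n ?invr_gt0//.
    by apply: le_trans h _; rewrite ler_nat.
have F0 n : (n.+2%:R^-1 : R) < 1 by rewrite invf_lt1 ?ltr1n ?ltr0n.
have cvgF : (\int[mu]_(x in F n) (x `^ (q - 1))%:E @[n --> \oo] --> \int[mu]_(x in \bigcup_n F n) (x `^ (q - 1))%:E)%E.
  apply: ge0_nondecreasing_set_cvg_integral => //.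
  - move=> m n mn; apply/subsetPset => x; rewrite /F/= !in_itv/= => /andP[+ ->].
    rewrite andbT; apply: le_trans; rewrite lef_pV2 ?posrE ?ltr0n// ler_nat.
    by rewrite !ltnS.
  - by move=> n; exact: measurable_itv.
  - by move=> n; exact: mpow.
  - by move=> n x _; rewrite lee_fin powR_ge0.
rewrite -(cvg_lim _ cvgF)//; apply: lime_le.
  by apply/cvg_ex; eexists; exact: cvgF.
apply: nearW => n; rewrite /F.
have n0 : 0 < (n.+2%:R^-1 : R) by rewrite invr_gt0 ltr0n.
have dF (x : R) : n.+2%:R^-1 <= x <= 1 ->
    is_derive x 1 (fun x => q^-1 * x `^ q) (x `^ (q - 1)).
  move=> /andP[nx _]; have x0 : 0 < x by exact: lt_le_trans nx.
  have := is_derive1_powR q x0.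
  move=> /(is_deriveZ q^-1); rewrite /GRing.scale/= mulrA mulVf ?mul1r//.
  by rewrite gt_eqF.
rewrite (integral_smooth_FTC2 (F0 n) dF).
  rewrite lee_fin powR1 mulr1 lerBlDr lerDl mulr_ge0 ?powR_ge0//.
  by rewrite invr_ge0 ltW.
move=> x /andP[nx x1]; have x0 : 0 < x by exact: lt_le_trans nx.
exact: continuous_powR_gt0.
Qed.

(** The density of the Beta distribution up to normalisation.  At the endpoints
    a negative exponent gives the value 0, by the convention for powers of 0. *)
Definition beta_kernel {R : realType} (p q u : R) : R :=
  (1 - u) `^ (p - 1) * u `^ (q - 1).

Lemma beta_kernel_ge0 (R : realType) (p q u : R) : 0 <= beta_kernel p q u.
Proof. by rewrite mulr_ge0 ?powR_ge0. Qed.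

Lemma measurable_beta_kernel (R : realType) (p q : R) (D : set R) :
  measurable_fun D (beta_kernel p q).
Proof.
apply: measurable_funM; apply: measurable_powR_comp; last exact: measurable_id.
exact: measurable_funB.
Qed.

Lemma integrable_powR10 (R : realType) (q : R) : 0 < q ->
  mu.-integrable (`[0, 1] : set R) (EFin \o (fun u => (1 - u) `^ (q - 1))).
Proof.
move=> q0; apply/integrableP; split.
  apply/measurable_EFinP; apply: measurable_powR_comp; exact: measurable_funB.
have := integrable_powR01 q0 => /integrableP[mf].
have N10 : (-1 : R) != 0 by rewrite oppr_eq0 oner_eq0.
rewrite (ge0_integral_affine 1 N10)//; last exact: measurableT_comp.
rewrite normrN1 mul1e.
rewrite (_ : _ @^-1` _ = `[0, 1]%classic); last first.
  by apply/seteqP; split => u /=; rewrite !in_itv/= => /andP[u0 u1]; apply/andP; split; lra.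
by under eq_integral do rewrite /= mulN1r.
Qed.

Lemma le_powR_nonneg (R : realType) (r x y : R) : 0 <= r -> 0 <= x -> x <= y ->
  x `^ r <= y `^ r.
Proof.
by move=> r0 x0 xy; rewrite ge0_ler_powR// nnegrE//; exact: le_trans xy.
Qed.

Lemma le_powR_nonpos (R : realType) (r x y : R) : r <= 0 -> 0 < x -> x <= y ->
  y `^ r <= x `^ r.
Proof.
move=> r0 x0 xy; rewrite -(opprK r) !(powRN _ (- r)).
rewrite lef_pV2 ?posrE ?powR_gt0//; last exact: lt_le_trans xy.
by rewrite le_powR_nonneg ?oppr_ge0// ltW.
Qed.

(** Away from 0 a power is bounded whatever the sign of its exponent; this
    bounds the nonsingular factor of the beta kernel on each half of the unit
    interval. *)
Lemma powR_le_half (R : realType) (p u : R) : 2^-1 <= u <= 1 ->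
  u `^ (p - 1) <= 1 + 2 `^ (1 - p).
Proof.
move=> /andP[u0 u1]; have [p1|p1] := leP 1 p.
  have : u `^ (p - 1) <= 1 `^ (p - 1) by apply: le_powR_nonneg => //; lra.
  by rewrite powR1 => /le_trans; apply; rewrite lerDl powR_ge0.
have : u `^ (p - 1) <= 2^-1 `^ (p - 1) by apply: le_powR_nonpos => //; lra.
move=> /le_trans; apply.
by rewrite -powR_inv1// -powRrM mulN1r opprB lerDr.
Qed.

(** On each half of the unit interval one of the two factors is bounded and the
    other is integrable. *)
Lemma integrable_beta_kernel (R : realType) (p q : R) : 0 < p -> 0 < q ->
  mu.-integrable (`[0, 1] : set R) (EFin \o beta_kernel p q).
Proof.
move=> p0 q0.
pose C : R := (1 + 2 `^ (1 - p)) + (1 + 2 `^ (1 - q)).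
have i1 := integrable_powR01 q0; have i2 := integrable_powR10 p0.
have i3 : mu.-integrable (`[0, 1] : set R)
    (EFin \o (fun u => C * (u `^ (q - 1) + (1 - u) `^ (p - 1)))).
  exact/LintegrableZ/LintegrableD.
apply: Lintegrable_le i3 => //; first exact: measurable_beta_kernel.
move=> u /=; rewrite in_itv/= => /andP[u0 u1].
rewrite ger0_norm ?beta_kernel_ge0//.
have [a0 b0] : 0 <= u `^ (q - 1) /\ 0 <= (1 - u) `^ (p - 1) by rewrite !powR_ge0.
have [c0 d0] : 0 <= 2 `^ (1 - q) /\ 0 <= 2 `^ (1 - p) :> R by rewrite !powR_ge0.
rewrite /beta_kernel; have [h|h] := leP u 2^-1.
- have : (1 - u) `^ (p - 1) <= 1 + 2 `^ (1 - p) by apply: powR_le_half; lra.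
  by rewrite /C; nra.
- have : u `^ (q - 1) <= 1 + 2 `^ (1 - q) by apply: powR_le_half; lra.
  by rewrite /C; nra.
Qed.

(** * The Beta integral on an interval *)

Lemma continuous_itv_bounded (R : realType) (f : R -> R) (a b : R) : a <= b ->
  {within `[a, b], continuous f} ->
  exists2 C : R, 0 <= C & forall x, a <= x <= b -> `|f x| <= C.
Proof.
move=> ab cf.
have cnf : {within `[a, b], continuous (fun x => `|f x|)}.
  by move=> x; apply: continuous_comp => //; [exact: cf|exact: norm_continuous].
have [c _ Hc] := EVT_max ab cnf.
by exists `|f c| => // x xab; apply: Hc; rewrite in_itv.
Qed.

Lemma preimage_itv_affine (R : realType) (r t : R) : r < t ->
  (fun u => r + (t - r) * u) @^-1` `[r, t]%classic = `[0, 1]%classic.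
Proof.
move=> rt; apply/seteqP; split => u /=; rewrite !in_itv/= => /andP[u0 u1]; apply/andP.
- have tr : 0 < t - r by rewrite subr_gt0.
  split; first by rewrite -(pmulr_rge0 _ tr); lra.
  by rewrite -(ler_pM2l tr); lra.
- by split; nra.
Qed.

Lemma integrable_rescale (R : realType) (G : R -> R) (r t : R) : r < t ->
  measurable_fun `[r, t] G ->
  mu.-integrable `[r, t] (EFin \o G) <->
  mu.-integrable (`[0, 1] : set R) (EFin \o (fun u => G (r + (t - r) * u))).
Proof.
move=> rt mG; have tr : t - r != 0 by rewrite gt_eqF// subr_gt0.
have H : (\int[mu]_(s in `[r, t]) `|(G s)%:E| =
    `|t - r|%:E * \int[mu]_(u in `[0%R, 1%R]) `|(G (r + (t - r) * u)%R)%:E|)%E.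
  rewrite (ge0_integral_affine r tr) ?preimage_itv_affine//.
  by apply: measurableT_comp => //; exact/measurable_EFinP.
have mGc : measurable_fun (`[0, 1] : set R) (fun u => G (r + (t - r) * u)).
  apply: (measurable_comp _ _ mG) => //.
  - by rewrite -(preimage_itv_affine rt) => _ [u /= h <-].
  - exact: affine_measurable.
split=> /integrableP[_ fi]; apply/integrableP; split => //; try exact/measurable_EFinP.
- move: fi; rewrite /= H; case: (\int[mu]_(_ in _) _)%E => [s _| |//]; first by rewrite ltry.
  by rewrite gt0_muley ?lte_fin ?normr_gt0.
- by rewrite /= H lte_mul_pinfty.
Qed.

(** Applied with r = 0, this moves the integrals over [0, t] of a Volterra
    operator to the fixed domain [0, 1]. *)
Lemma Rintegral_rescale (R : realType) (G : R -> R) (r t : R) : r < t ->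
  mu.-integrable `[r, t] (EFin \o G) ->
  \int[mu]_(s in `[r, t]) G s =
    (t - r) * \int[mu]_(u in `[0, 1]) G (r + (t - r) * u).
Proof.
move=> rt iG; have tr : 0 < t - r by rewrite subr_gt0.
have mG : measurable_fun `[r, t] G.
  by move/integrableP : iG => [/measurable_EFinP].
have iGc := (integrable_rescale rt mG).1 iG.
rewrite -RintegralZl// /Rintegral; congr fine.
rewrite [LHS]integralE [RHS]integralE.
have H (f : R -> \bar R) : measurable_fun `[r, t] f -> (forall x, 0 <= f x)%E ->
  (\int[mu]_(s in `[r, t]) f s =
   \int[mu]_(u in `[0%R, 1%R]) ((t - r)%:E * f (r + (t - r) * u)%R))%E.
  move=> mf f0; rewrite (ge0_integral_affine r (lt0r_neq0 tr))//.
  rewrite preimage_itv_affine// gtr0_norm// -ge0_integralZl//.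
  - apply: (measurable_comp _ _ mf) => //.
    + by rewrite -(preimage_itv_affine rt) => _ [u /= h <-].
    + exact: affine_measurable.
  - by rewrite lee_fin ltW.
congr (_ - _)%E.
- rewrite H//; last by apply: measurable_funepos; exact/measurable_EFinP.
  apply: eq_integral => u _; rewrite !funeposE /=.
  by rewrite maxe_pMr ?lee_fin ?(ltW tr)// mule0.
- rewrite H//; last by apply: measurable_funeneg; exact/measurable_EFinP.
  apply: eq_integral => u _; rewrite !funenegE /=.
  by rewrite maxe_pMr ?lee_fin ?(ltW tr)// mule0 -EFinM mulrN.
Qed.

Definition Beta {R : realType} (p q : R) : R :=
  \int[mu]_(u in `[0, 1]) beta_kernel p q u.

Lemma beta_kernel_affine (R : realType) (p q r t u : R) : r < t -> 0 <= u <= 1 ->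
  (t - (r + (t - r) * u)) `^ (p - 1) * (r + (t - r) * u - r) `^ (q - 1) =
  (t - r) `^ (p + q - 2) * beta_kernel p q u.
Proof.
move=> rt /andP[u0 u1]; have tr : 0 < t - r by rewrite subr_gt0.
rewrite (_ : t - (r + (t - r) * u) = (t - r) * (1 - u)); last by ring.
rewrite (_ : r + (t - r) * u - r = (t - r) * u); last by ring.
rewrite !powRM ?subr_ge0// ?(ltW tr) ?ltW// /beta_kernel.
rewrite (_ : p + q - 2 = (p - 1) + (q - 1)); last by ring.
by rewrite (@powRD _ (t - r) (p - 1)) ?(gt_eqF tr) ?implybT//; ring.
Qed.

Lemma measurable_beta_itv (R : realType) (p q r t : R) (D : set R) :
  measurable_fun D (fun s => (t - s) `^ (p - 1) * (s - r) `^ (q - 1)).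
Proof.
apply: measurable_funM; apply: measurable_powR_comp; exact: measurable_funB.
Qed.

Lemma integrable_beta_itv (R : realType) (p q r t : R) : 0 < p -> 0 < q -> r < t ->
  mu.-integrable `[r, t]
    (EFin \o (fun s => (t - s) `^ (p - 1) * (s - r) `^ (q - 1))).
Proof.
move=> p0 q0 rt; apply/integrable_rescale => //; first exact: measurable_beta_itv.
have := LintegrableZ ((t - r) `^ (p + q - 2)) (measurable_itv `[0, 1])
  (integrable_beta_kernel p0 q0).
by apply: eq_integrable => // u /set_mem/=; rewrite in_itv/= => u01; rewrite beta_kernel_affine.
Qed.

(** For p + q = 1 the value does not depend on the interval; this is what
    inverts the fractional integral. *)
Lemma Rintegral_beta_itv (R : realType) (p q r t : R) : 0 < p -> 0 < q -> r < t ->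
  \int[mu]_(s in `[r, t]) ((t - s) `^ (p - 1) * (s - r) `^ (q - 1)) =
  (t - r) `^ (p + q - 1) * Beta p q.
Proof.
move=> p0 q0 rt; rewrite (Rintegral_rescale rt (integrable_beta_itv p0 q0 rt)).
under eq_Rintegral => u /set_mem/=.
  rewrite in_itv/= => u01; rewrite beta_kernel_affine//; over.
rewrite RintegralZl//; last exact: integrable_beta_kernel.
rewrite mulrA; congr (_ * _).
have tr : 0 < t - r by rewrite subr_gt0.
rewrite -[X in X * _](powRr1 (ltW tr)) -powRD ?(gt_eqF tr) ?implybT//.
by congr (_ `^ _); ring.
Qed.

Lemma Beta_gt0 (R : realType) (p q : R) : 0 < p <= 1 -> 0 < q <= 1 -> 0 < Beta p q.
Proof.
move=> /andP[p0 p1] /andP[q0 q1].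
have I1 : \int[@lebesgue_measure R]_(u in (`]0, 1[ : set R)) 1 = 1.
  rewrite Rintegral_cst// mul1r.
  have := lebesgue_measure_itv_side false true (0 : R) 1.
  by rewrite ltr01 subr0 => /(congr1 fine).
apply: (@lt_le_trans _ _ 1) => //; rewrite -I1.
have ib := integrable_beta_kernel p0 q0.
have ibo : mu.-integrable (`]0, 1[ : set R) (EFin \o beta_kernel p q).
  by apply: integrableS ib => //; exact: subset_itv_oo_cc.
have -> : Beta p q = \int[mu]_(u in `]0, 1[) beta_kernel p q u.
  rewrite /Beta /Rintegral integral_itv_bndoo//.
  exact: measurable_int ibo.
apply: le_Rintegral => //.
  have ic : mu.-integrable (`[0, 1] : set R) (EFin \o cst 1).
    apply: Lintegrable_continuous; apply: continuous_within_of => x _.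
    exact: cst_continuous.
  by apply: integrableS ic => //; exact: subset_itv_oo_cc.
move=> u /=; rewrite in_itv/= => /andP[u0 u1].
rewrite -[leLHS]mul1r /beta_kernel ler_pM//.
- have := @le_powR_nonpos R (p - 1) (1 - u) 1; rewrite powR1; apply; lra.
- have := @le_powR_nonpos R (q - 1) u 1; rewrite powR1; apply; lra.
Qed.

Lemma integrable_kernel (R : realType) (p r t : R) : 0 < p -> r < t ->
  mu.-integrable `[r, t] (EFin \o (fun s => (t - s) `^ (p - 1))).
Proof.
move=> p0 rt; have := integrable_beta_itv p0 ltr01 rt.
by apply: eq_integrable => // s _ /=; rewrite subrr powRr0 mulr1.
Qed.

(** * Integrals against the singular kernel *)

(** Near t the kernel is singular and v is bounded; near 0 it is the other way
    round.  Hence K |v| + C (t - s) `^ (p - 1) is an integrable majorant. *)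
Lemma caputo_kernel_integrable (R : realType) (p t : R) (v : R -> R) :
  0 < p -> 0 < t ->
  (forall s, 0 < s <= t -> {for s, continuous v}) ->
  mu.-integrable `]0, t[ (EFin \o v) ->
  mu.-integrable `[0, t] (EFin \o (fun s => (t - s) `^ (p - 1) * v s)).
Proof.
move=> p0 t0 cv /integrable_oo_cc iv.
have mv : measurable_fun `[0, t] v by move/integrableP : iv => [/measurable_EFinP].
have [C C0 HC] : exists2 C : R, 0 <= C & forall s, t / 2 <= s <= t -> `|v s| <= C.
  apply: continuous_itv_bounded; first lra.
  by apply: continuous_within_of => s /=; rewrite in_itv/= => /andP[? ?]; apply: cv; lra.
have [K K0 HK] : exists2 K : R, 0 <= K & forall s, 0 <= s <= t / 2 -> `|(t - s) `^ (p - 1)| <= K.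
  apply: continuous_itv_bounded; first lra.
  apply: continuous_within_of => s /=; rewrite in_itv/= => /andP[s0 st].
  apply: (@continuous_comp_powR _ (fun s => t - s)); first by lra.
  by apply: cvgB; [exact: cvg_cst|exact: cvg_id].
have ik := integrable_kernel p0 t0.
have mk : measurable_fun `[0, t] (fun s => (t - s) `^ (p - 1)).
  by apply: measurable_powR_comp; exact: measurable_funB.
apply: (@Lintegrable_le _ _ _ (fun s => K * `|v s| + C * (t - s) `^ (p - 1))) => //.
- exact: measurable_funM.
- move=> s /=; rewrite in_itv/= => /andP[s0 st]; rewrite normrM.
  have [h|h] := leP s (t / 2).
  + apply: (@le_trans _ _ (K * `|v s|)); last by rewrite lerDl mulr_ge0// powR_ge0.
    by rewrite ler_wpM2r// HK// s0 h.
  + apply: (@le_trans _ _ (C * (t - s) `^ (p - 1))); last by rewrite lerDr mulr_ge0.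
    by rewrite ger0_norm ?powR_ge0// mulrC ler_wpM2r ?powR_ge0// HC// (ltW h) st.
- apply: LintegrableD => //; apply: LintegrableZ => //.
  exact: integrable_norm iv.
Qed.

Lemma powR_small (R : realType) (q e : R) : 0 < q -> 0 < e ->
  exists2 d : R, 0 < d & forall x, 0 <= x <= d -> x `^ q < e.
Proof.
move=> q0 e0; exists ((e / 2) `^ q^-1); first by rewrite powR_gt0// divr_gt0.
move=> x /andP[x0 xd]; apply: (@le_lt_trans _ _ (e / 2)); last lra.
have := le_powR_nonneg (ltW q0) x0 xd.
by rewrite -powRrM mulVf ?gt_eqF// powRr1// divr_ge0// ltW.
Qed.

(** Near t the derivative is bounded, so d t - d s is of order t - s.  This
    makes the boundary term of the integration by parts in [kernel_touch] vanish
    at the singularity. *)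
Lemma increment_bound (R : realType) (d d' : R -> R) (t : R) : 0 < t ->
  (forall s, 0 < s <= t -> is_derive s 1 d (d' s)) ->
  (forall s, 0 < s <= t -> {for s, continuous d'}) ->
  exists2 C : R, 0 <= C & forall s, t / 2 <= s <= t -> d t - d s <= C * (t - s).
Proof.
move=> t0 dd cd.
have [C C0 HC] : exists2 C : R, 0 <= C & forall s, t / 2 <= s <= t -> `|d' s| <= C.
  apply: continuous_itv_bounded; first lra.
  by apply: continuous_within_of => s /=; rewrite in_itv/= => /andP[? ?]; apply: cd; lra.
exists C => // s /andP[s1]; rewrite le_eqVlt => /predU1P[->|st].
  by rewrite !subrr mulr0.
have [c|c|c] := @MVT R d d' s t st.
- by rewrite in_itv/= => /andP[? ?]; apply: dd; lra.
- apply: continuous_within_of => u /=; rewrite in_itv/= => /andP[? ?].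
  by apply: is_derive_continuous; apply: dd; lra.
rewrite in_itv/= => /andP[sc ct] ->; rewrite ler_wpM2r ?subr_ge0 ?(ltW st)//.
by rewrite (le_trans (ler_norm _))// HC//; apply/andP; split; lra.
Qed.

(** Integration by parts against k(s) = (t - s) `^ (- al): with Q = k (d t - d),
    the integrand k d' is at least - Q', because k increases and d t - d is
    nonnegative.  The boundary term at a has the right sign and is dropped. *)
Lemma kernel_touch_inner (R : realType) (al : R) (d d' : R -> R) (t a b : R) :
  0 < al -> 0 < a -> a < b -> b < t ->
  (forall s, 0 < s <= t -> is_derive s 1 d (d' s)) ->
  (forall s, 0 < s <= t -> {for s, continuous d'}) ->
  (forall s, 0 < s <= t -> d s <= d t) ->
  - ((t - b) `^ (1 - al - 1) * (d t - d b)) <=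
    \int[mu]_(s in `[a, b]) ((t - s) `^ (1 - al - 1) * d' s).
Proof.
move=> al0 a0 ab bt dd cd dmax.
pose k s := (t - s) `^ (1 - al - 1).
pose k' s := al * (t - s) `^ (1 - al - 1 - 1).
pose Q s := k s * (d t - d s).
pose Q' s := k' s * (d t - d s) - k s * d' s.
have dQ s : a <= s <= b -> is_derive s 1 Q (Q' s).
  move=> /andP[as_ sb]; have ts : 0 < t - s by lra.
  have h1 : is_derive s 1 (fun s => t - s) (0 - 1) by exact: is_deriveB.
  have h2 := @is_derive1_comp _ (fun x => x `^ (1 - al - 1)) (fun s => t - s) s _ _
     (is_derive1_powR (1 - al - 1) ts) h1.
  have ds : is_derive s 1 d (d' s) by apply: dd; lra.
  have h3 : is_derive s 1 (fun s => d t - d s) (0 - d' s) by exact: is_deriveB.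
  have := is_deriveM h2 h3; rewrite /GRing.scale/=.
  move=> h4; apply: (is_derive_eq h4); rewrite /Q' /k' /k; ring.
have cts s : a <= s <= b -> {for s, continuous (fun s : R => t - s)}.
  by move=> _; apply: cvgB; [exact: cvg_cst|exact: cvg_id].
have ck s q : a <= s <= b -> {for s, continuous (fun s => (t - s) `^ q)}.
  move=> h; apply: (@continuous_comp_powR _ (fun s => t - s)); last exact: cts h.
  by move/andP : h => [? ?]; lra.
have cd' s : a <= s <= b -> {for s, continuous d'} by move=> /andP[? ?]; apply: cd; lra.
have cd0 s : a <= s <= b -> {for s, continuous d}.
  by move=> /andP[? ?]; apply: is_derive_continuous; apply: dd; lra.
have ckd s : a <= s <= b -> {for s, continuous (fun s => k s * d' s)}.
  by move=> h; apply: cvgM; [exact: ck|exact: cd'].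
have cQ' s : a <= s <= b -> {for s, continuous Q'}.
  move=> h; apply: cvgB; last exact: ckd.
  apply: cvgM; last by apply: cvgB; [exact: cvg_cst|exact: cd0].
  by apply: cvgM; [exact: cvg_cst|exact: ck].
have IQ : \int[mu]_(s in `[a, b]) (- Q' s) = Q a - Q b.
  have dNQ s : a <= s <= b -> is_derive s 1 (fun s => - Q s) (- Q' s).
    by move=> /dQ h; exact: is_deriveN.
  have cNQ s : a <= s <= b -> {for s, continuous (fun s => - Q' s)}.
    by move=> /cQ' h; exact: cvgN.
  by rewrite /Rintegral (integral_smooth_FTC2 ab dNQ cNQ)/=; ring.
have Qa : 0 <= Q a by rewrite mulr_ge0 ?powR_ge0// subr_ge0 dmax//; lra.
apply: (@le_trans _ _ (Q a - Q b)); first by rewrite lerDr.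
rewrite -IQ; apply: le_Rintegral => //.
- apply: Lintegrable_continuous; apply: continuous_within_of => s /=.
  by rewrite in_itv/= => /cQ' h; exact: cvgN.
- apply: Lintegrable_continuous; apply: continuous_within_of => s /=.
  by rewrite in_itv/= => /ckd.
- move=> s /=; rewrite in_itv/= => /andP[as_ sb].
  rewrite /Q' opprB lerBlDr lerDl /k' !mulr_ge0 ?powR_ge0 ?(ltW al0)//.
  by rewrite subr_ge0 dmax//; lra.
Qed.

(** * The extremum principle for the singular kernel *)

(** Limit of [kernel_touch_inner] as the interval exhausts [0, t]: the remaining
    boundary term is at most C h `^ (1 - al) by [increment_bound]. *)
Lemma kernel_touch (R : realType) (al : R) (d d' : R -> R) (t : R) :
  0 < al < 1 -> 0 < t ->
  (forall s, 0 < s <= t -> is_derive s 1 d (d' s)) ->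
  (forall s, 0 < s <= t -> {for s, continuous d'}) ->
  mu.-integrable `]0, t[ (EFin \o d') ->
  (forall s, 0 < s <= t -> d s <= d t) ->
  0 <= \int[mu]_(s in `[0, t]) ((t - s) `^ (1 - al - 1) * d' s).
Proof.
move=> /andP[al0 al1] t0 dd cd id' dmax.
have p0 : 0 < 1 - al by lra.
have ik := caputo_kernel_integrable p0 t0 cd id'.
pose f s := (t - s) `^ (1 - al - 1) * d' s.
rewrite -/(f _) in ik *.
pose P x := \int[mu]_(s in `[0, x]) f s.
rewrite -/(P t) leNgt; apply/negP => Pt.
have [C C0 HC] := increment_bound t0 dd cd.
(* The two ends of [0, t] and the boundary term are each allowed a third. *)
pose e := - P t / 3.
have e0 : 0 < e by rewrite /e; lra.
have [_ P0 Ptl] := (continuous_within_itvP _ t0).1 (parameterized_integral_continuous (ltW t0) ik).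
have {P0} [d1 /= d10 H1] : \forall x \near 0^'+, `|P 0 - P x| < e by move/cvgrPdist_lt : P0; exact.
have {Ptl} [d2 /= d20 H2] : \forall x \near t^'-, `|P t - P x| < e by move/cvgrPdist_lt : Ptl; exact.
have [d3 d30 H3] : exists2 d3 : R, 0 < d3 & forall x, 0 <= x <= d3 -> C * x `^ (1 - al) < e.
  have [d3 d30 H3] := powR_small p0 (divr_gt0 e0 (ltr_pwDr ltr01 C0)).
  exists d3 => // x /H3; rewrite ltr_pdivlMr; last lra.
  by apply: le_lt_trans; rewrite mulrC ler_wpM2l ?powR_ge0//; lra.
pose h := Num.min (Num.min (d1 / 2) (d2 / 2)) (Num.min d3 (t / 3)).
have h0 : 0 < h by rewrite !lt_min; apply/andP; split; apply/andP; split; lra.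
have [hd1 hd2] : h <= d1 / 2 /\ h <= d2 / 2 by split; rewrite /h !ge_min lexx ?orbT.
have [hd3 hd4] : h <= d3 /\ h <= t / 3 by split; rewrite /h !ge_min lexx ?orbT.
have P00 : P 0 = 0 by rewrite /P set_itv1 Rintegral_set1.
have {}H1 := H1 h; rewrite /ball_/= P00 !sub0r !normrN gtr0_norm// in H1.
have {}H1 : `|P h| < e by apply: H1 => //; lra.
have {}H2 : `|P t - P (t - h)| < e.
  by apply: H2; rewrite /ball_/= ?opprB ?subKr ?gtr0_norm//; lra.
have ab : h < t - h by lra.
have := kernel_touch_inner al0 h0 ab _ dd cd dmax.
have -> : \int[mu]_(s in `[h, t - h]) ((t - s) `^ (1 - al - 1) * d' s) = P (t - h) - P h.
  have i1 : mu.-integrable `[0, t - h] (EFin \o f).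
    by apply: integrableS ik => //; apply: subset_itvl; rewrite bnd_simp; lra.
  have i2 : mu.-integrable `]h, t - h] (EFin \o f).
    by apply: integrableS i1 => //; apply: subset_itvr; rewrite bnd_simp; lra.
  rewrite -[LHS](Rintegral_itv_obnd_cbnd i2).
  by rewrite (Rintegral_itvB i1) ?bnd_simp//; lra.
move=> /(_ ltac:(lra)); rewrite subKr => HI.
have hh : h `^ (1 - al - 1) * (C * h) = C * h `^ (1 - al).
  rewrite mulrCA; congr (_ * _).
  rewrite -[X in _ * X = _](powRr1 (ltW h0)) -powRD ?(gt_eqF h0) ?implybT//.
  by congr (_ `^ _); ring.
have HCh := HC (t - h); rewrite subKr in HCh *.
have {}HCh : d t - d (t - h) <= C * h by apply: HCh; lra.
have H3' : C * h `^ (1 - al) < e by apply: H3; lra.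
have : h `^ (1 - al - 1) * (d t - d (t - h)) <= h `^ (1 - al - 1) * (C * h).
  by rewrite ler_wpM2l ?powR_ge0.
rewrite hh => HJ; move: H1 H2; rewrite !ltr_norml /e => /andP[? ?] /andP[? ?].
by rewrite /e in H3'; lra.
Qed.

(** A negative derivative at t would, by its continuity, make d larger shortly
    before t.  This is the case of order 1, in which the kernel degenerates. *)
Lemma derive_touch (R : realType) (d d' : R -> R) (t : R) : 0 < t ->
  (forall s, 0 < s <= t -> is_derive s 1 d (d' s)) ->
  (forall s, 0 < s <= t -> {for s, continuous d'}) ->
  (forall s, 0 < s <= t -> d s <= d t) ->
  0 <= d' t.
Proof.
move=> t0 dd cd dmax; rewrite leNgt; apply/negP => d't.
have ct : {for t, continuous d'} by apply: cd; rewrite t0 lexx.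
have [e /= e0 He] : \forall s \near t, `|d' t - d' s| < - d' t.
  by move/cvgrPdist_lt : ct; apply; lra.
pose h := Num.min (e / 2) (t / 2).
have h0 : 0 < h by rewrite lt_min; apply/andP; split; lra.
have [h1 h2] : h <= e / 2 /\ h <= t / 2 by split; rewrite /h !ge_min lexx ?orbT.
have th : t - h < t by lra.
have [c|c|c] := @MVT R d d' (t - h) t th.
- by rewrite in_itv/= => /andP[? ?]; apply: dd; lra.
- apply: continuous_within_of => u /=; rewrite in_itv/= => /andP[? ?].
  by apply: is_derive_continuous; apply: dd; lra.
rewrite in_itv/= => /andP[tc ct']; rewrite subKr => E.
have {}He : `|d' t - d' c| < - d' t.
  by apply: He; rewrite /ball_/= gtr0_norm; lra.
have : d (t - h) <= d t by apply: dmax; lra.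
rewrite -subr_ge0 E pmulr_lge0//.
by move: He; rewrite ltr_norml => /andP[? ?]; lra.
Qed.

(** The regularity that a solution on an interval beyond t has on ]0, t]. *)
Definition frac_regular {R : realType} (x : R -> R) (t : R) :=
  (forall s, 0 < s <= t -> derivable x s 1 /\ {for s, continuous x^`()%classic}) /\
  mu.-integrable `]0, t[ (EFin \o x^`()%classic).

(** * Monotonicity properties of the Caputo derivative *)

(** The factor expR (- s) is bounded near 0, and s `^ (p - 1) is bounded beyond
    1. *)
Lemma Gamma_integrable (R : realType) (p : R) : 0 < p <= 1 ->
  mu.-integrable `]0, +oo[ (EFin \o (fun s : R => s `^ (p - 1) * expR (- s))).
Proof.
move=> /andP[p0 p1].
have i1 : mu.-integrable `]0, +oo[ (EFin \o exponential_pdf (1 : R)).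
  by apply: integrableS (integrable_exponential_pdf ltr01).
have i2 : mu.-integrable `]0, +oo[
    (EFin \o ((fun s : R => s `^ (p - 1)) \_ (`]0, 1] : set R))).
  rewrite -restrict_EFin; apply/integrable_restrict => //.
  apply: integrableS (integrable_powR01 p0) => //; first exact: measurableI.
  by move=> s /= [_]; apply: subset_itvr; rewrite bnd_simp.
apply: Lintegrable_le (LintegrableD _ i1 i2) => //.
  apply: measurable_funM; first exact: measurable_powR_comp.
  apply: (@measurable_fun_continuousT _ _ (fun s => expR (- s))) => // s.
  by apply: continuous_comp; [exact: opp_continuous|exact: continuous_expR].
move=> s /=; rewrite in_itv/= andbT => s0.
rewrite ger0_norm ?mulr_ge0 ?powR_ge0 ?expR_ge0//.
rewrite exponential_pdfE ?(ltW s0)// mul1r mulN1r.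
rewrite patchE; case: ifPn => [_|]; last first.
  rewrite notin_setE/= in_itv/= s0/= => /negP; rewrite -ltNge => s1.
  rewrite addr0 ler_piMl ?expR_ge0//.
  by have := @le_powR_nonpos R (p - 1) 1 s; rewrite powR1; apply; lra.
rewrite (@le_trans _ _ (s `^ (p - 1)))// ?lerDr ?expR_ge0//.
by rewrite ler_piMr ?powR_ge0// -expR0 ler_expR; lra.
Qed.

(** Positivity is read off the interval [1, 2]. *)
Lemma Gamma_gt0 (R : realType) (p : R) : 0 < p <= 1 -> 0 < Gamma p.
Proof.
move=> p01; have ig := Gamma_integrable p01; move/andP: p01 => [p0 p1].
have sub : (`[1, 2] : set R) `<=` `]0, +oo[.
  by move=> s /=; rewrite !in_itv/= => /andP[s1 _]; rewrite andbT; lra.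
have ig1 : mu.-integrable (`[1, 2] : set R) (EFin \o (fun s => s `^ (p - 1) * expR (- s))).
  by apply: integrableS ig.
pose c : R := 2 `^ (p - 1) * expR (- 2).
apply: (@lt_le_trans _ _ (\int[mu]_(s in (`[1, 2] : set R)) c)).
  rewrite Rintegral_cst//; apply: mulr_gt0; first by rewrite mulr_gt0 ?powR_gt0 ?expR_gt0.
  have := lebesgue_measure_itv_side true false (1 : R) 2.
  rewrite ltr1n => /(congr1 fine)/= E.
  by apply: (@lt_le_trans _ _ (2 - 1)); [lra|rewrite -E].
apply: (@le_trans _ _ (\int[mu]_(s in (`[1, 2] : set R)) (s `^ (p - 1) * expR (- s)))).
  apply: le_Rintegral => //.
    apply: Lintegrable_continuous; apply: continuous_within_of => x _.
    exact: cst_continuous.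
  move=> s /=; rewrite in_itv/= => /andP[s1 s2]; rewrite ler_pM ?powR_ge0 ?expR_ge0//.
    by apply: le_powR_nonpos; lra.
  by rewrite ler_expR; lra.
apply: fine_le; [exact: integrable_fin_num ig1|exact: integrable_fin_num ig|].
apply: ge0_subset_integral => //; first exact: measurable_int ig.
by move=> s _; rewrite lee_fin mulr_ge0 ?powR_ge0 ?expR_ge0.
Qed.

Lemma frac_regular_deriv (R : realType) (x : R -> R) (t : R) :
  frac_regular x t ->
  forall s, 0 < s <= t -> is_derive s 1 x (x^`()%classic s).
Proof.
move=> [h _] s st; have [dx _] := h s st.
by rewrite derive1E; apply: DeriveDef.
Qed.

Lemma frac_regular_cont (R : realType) (x : R -> R) (t : R) :
  frac_regular x t ->
  forall s, 0 < s <= t -> {for s, continuous x^`()%classic}.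
Proof. by move=> [h _] s st; have [] := h s st. Qed.

Lemma caputo1 (R : realType) (x : R -> R) (t : R) :
  caputo 1 x t = x^`()%classic t.
Proof. by rewrite /caputo /frac_int subrr eqxx. Qed.

Lemma caputo_lt1 (R : realType) (al : R) (x : R -> R) (t : R) : al < 1 ->
  caputo al x t = (Gamma (1 - al))^-1 *
    \int[mu]_(s in `[0, t]) ((t - s) `^ (1 - al - 1) * x^`()%classic s).
Proof. by move=> al1; rewrite /caputo /frac_int gt_eqF// subr_gt0. Qed.

(** The extremum principle: the Caputo derivative at t weighs the increments of
    the past by an increasing kernel, so it is nonnegative for a function that
    is largest at t. *)
Lemma caputo_touch (R : realType) (al : R) (x y : R -> R) (t : R) :
  0 < al <= 1 -> 0 < t -> frac_regular x t -> frac_regular y t ->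
  (forall s, 0 < s <= t -> x s - y s <= x t - y t) ->
  caputo al y t <= caputo al x t.
Proof.
move=> /andP[al0 al1] t0 rx ry xy.
pose d s := x s - y s.
pose d' s := x^`()%classic s - y^`()%classic s.
have dd s : 0 < s <= t -> is_derive s 1 d (d' s).
  move=> st; have h1 := frac_regular_deriv rx st; have h2 := frac_regular_deriv ry st.
  exact: is_deriveB.
have cd s : 0 < s <= t -> {for s, continuous d'}.
  by move=> st; apply: cvgB; [exact: (frac_regular_cont rx)|exact: (frac_regular_cont ry)].
have [al1'|al1'] := eqVneq al 1.
  rewrite al1' !caputo1 -subr_ge0.
  exact: (@derive_touch _ d d').
have {}al1 : al < 1 by rewrite lt_neqAle al1'.
have p0 : 0 < 1 - al by lra.
have G0 : 0 < (Gamma (1 - al))^-1.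
  by rewrite invr_gt0; apply: Gamma_gt0; apply/andP; split; lra.
rewrite (caputo_lt1 x t al1) (caputo_lt1 y t al1) (ler_pM2l G0).
have ix := caputo_kernel_integrable p0 t0 (frac_regular_cont rx) rx.2.
have iy := caputo_kernel_integrable p0 t0 (frac_regular_cont ry) ry.2.
rewrite -subr_ge0 -RintegralB//.
under eq_Rintegral do rewrite -mulrBr.
apply: (kernel_touch _ t0 dd cd) => //; first by rewrite al0.
by apply: LintegrableB => //; [exact: rx.2|exact: ry.2].
Qed.

(** The Caputo derivative of t `^ al / al, a constant. *)
Definition caputo_unit {R : realType} (al : R) : R :=
  if al == 1 then 1 else (Gamma (1 - al))^-1 * Beta (1 - al) al.

Lemma caputo_unit_gt0 (R : realType) (al : R) : 0 < al <= 1 -> 0 < caputo_unit al.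
Proof.
move=> /andP[al0 al1]; rewrite /caputo_unit; case: eqVneq => // al1'.
have {}al1 : al < 1 by rewrite lt_neqAle al1'.
rewrite mulr_gt0 ?invr_gt0 ?Gamma_gt0 ?Beta_gt0//; apply/andP; split; lra.
Qed.

Lemma power_kernel_integral (R : realType) (al c t : R) : 0 < al < 1 -> 0 < t ->
  mu.-integrable `]0, t]
    (EFin \o (fun s => (t - s) `^ (1 - al - 1) * (c * s `^ (al - 1)))) /\
  \int[mu]_(s in `]0, t]) ((t - s) `^ (1 - al - 1) * (c * s `^ (al - 1))) =
  c * Beta (1 - al) al.
Proof.
move=> /andP[al0 al1] t0; have p0 : 0 < 1 - al by lra.
have ib := integrable_beta_itv p0 al0 t0.
have ib1 : mu.-integrable `]0, t] (EFin \o (fun s => c * ((t - s) `^ (1 - al - 1) * (s - 0) `^ (al - 1)))).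
  apply: LintegrableZ => //; apply: integrableS ib => //.
  by apply: subset_itvr; rewrite bnd_simp.
have E : (fun s => (t - s) `^ (1 - al - 1) * (c * s `^ (al - 1))) =
    (fun s => c * ((t - s) `^ (1 - al - 1) * (s - 0) `^ (al - 1))).
  by apply/funext => s; rewrite subr0; ring.
split; first by rewrite E.
rewrite E (Rintegral_itv_obnd_cbnd ib1) (RintegralZl _ _ ib); last exact: measurable_itv.
rewrite (Rintegral_beta_itv p0 al0 t0).
by rewrite (_ : 1 - al + al - 1 = 0) ?powRr0 ?mul1r//; ring.
Qed.

(** The bound compares the derivative of x with that of c t `^ al / al, whose
    Caputo derivative is constant.  It is how all barriers are estimated. *)
Lemma caputo_le_power (R : realType) (al c : R) (x : R -> R) (t : R) :
  0 < al <= 1 -> 0 < t -> frac_regular x t ->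
  (forall s, 0 < s <= t -> x^`()%classic s <= c * s `^ (al - 1)) ->
  caputo al x t <= c * caputo_unit al.
Proof.
move=> /andP[al0 al1] t0 rx xc; rewrite /caputo_unit; case: eqVneq => [al1'|al1'].
  by rewrite al1' caputo1 mulr1; have := xc t; rewrite al1' subrr powRr0 mulr1 t0 lexx; apply.
have {}al1 : al < 1 by rewrite lt_neqAle al1'.
have al01 : 0 < al < 1 by rewrite al0.
have [ik Ek] := power_kernel_integral c al01 t0.
have p0 : 0 < 1 - al by lra.
have G0 : 0 < (Gamma (1 - al))^-1.
  by rewrite invr_gt0; apply: Gamma_gt0; apply/andP; split; lra.
rewrite (caputo_lt1 x t al1) mulrCA (ler_pM2l G0).
have ix := caputo_kernel_integrable p0 t0 (frac_regular_cont rx) rx.2.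
have ix1 : mu.-integrable `]0, t] (EFin \o (fun s => (t - s) `^ (1 - al - 1) * x^`()%classic s)).
  by apply: integrableS ix => //; apply: subset_itvr; rewrite bnd_simp.
(* The point 0 is left out, since the derivative of x there is arbitrary. *)
rewrite -(Rintegral_itv_obnd_cbnd ix1) -Ek; apply: le_Rintegral => //.
by move=> s /=; rewrite in_itv/= => st; rewrite ler_wpM2l ?powR_ge0// xc.
Qed.

Lemma caputo_ge_power (R : realType) (al c : R) (x : R -> R) (t : R) :
  0 < al <= 1 -> 0 < t -> frac_regular x t ->
  (forall s, 0 < s <= t -> c * s `^ (al - 1) <= x^`()%classic s) ->
  c * caputo_unit al <= caputo al x t.
Proof.
move=> /andP[al0 al1] t0 rx xc; rewrite /caputo_unit; case: eqVneq => [al1'|al1'].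
  by rewrite al1' caputo1 mulr1; have := xc t; rewrite al1' subrr powRr0 mulr1 t0 lexx; apply.
have {}al1 : al < 1 by rewrite lt_neqAle al1'.
have al01 : 0 < al < 1 by rewrite al0.
have [ik Ek] := power_kernel_integral c al01 t0.
have p0 : 0 < 1 - al by lra.
have G0 : 0 < (Gamma (1 - al))^-1.
  by rewrite invr_gt0; apply: Gamma_gt0; apply/andP; split; lra.
rewrite (caputo_lt1 x t al1) mulrCA (ler_pM2l G0).
have ix := caputo_kernel_integrable p0 t0 (frac_regular_cont rx) rx.2.
have ix1 : mu.-integrable `]0, t] (EFin \o (fun s => (t - s) `^ (1 - al - 1) * x^`()%classic s)).
  by apply: integrableS ix => //; apply: subset_itvr; rewrite bnd_simp.
(* The point 0 is left out, since the derivative of x there is arbitrary. *)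
rewrite -(Rintegral_itv_obnd_cbnd ix1) -Ek; apply: le_Rintegral => //.
by move=> s /=; rewrite in_itv/= => st; rewrite ler_wpM2l ?powR_ge0// xc.
Qed.

(** The majorant t `^ (al - 1) is integrable, which gives the integrability of
    the derivative near 0. *)
Lemma frac_regular_of (R : realType) (al C : R) (x v : R -> R) : 0 < al ->
  (forall s : R, 0 < s -> is_derive s 1 x (v s)) ->
  (forall s : R, 0 < s -> {for s, continuous v}) ->
  forall t : R, 0 < t -> (forall s : R, 0 < s < t -> `|v s| <= C * s `^ (al - 1)) ->
  frac_regular x t /\ (forall s : R, 0 < s -> x^`()%classic s = v s).
Proof.
move=> al0 dx cv t t0 vC.
have E (s : R) : 0 < s -> x^`()%classic s = v s.
  by move=> /dx h; rewrite derive1E; exact: derive_val.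
have cx (s : R) : 0 < s -> {for s, continuous x^`()%classic}.
  move=> s0; have h := cv s s0.
  rewrite /prop_for /continuous_at E//.
  apply: cvg_trans h; apply: near_eq_cvg.
  by near=> z; rewrite E//; near: z; exact: lt_nbhsr.
split => //; split.
  by move=> s /andP[s0 st]; split; [by have ? := dx s s0; exact: ex_derive|exact: cx].
apply: (@Lintegrable_le _ _ _ (fun s => C * (s - 0) `^ (al - 1))) => //.
- apply: open_continuous_measurable_fun => //.
  by move=> s; rewrite inE/= in_itv/= => /andP[s0 _]; exact: cx.
- by move=> s /=; rewrite in_itv/= => /andP[s0 st]; rewrite subr0 E// vC// s0.
- apply: LintegrableZ => //.
  have ib := integrable_beta_itv ltr01 al0 t0.
  have ib' : mu.-integrable `]0, t[
      (EFin \o (fun s => (t - s) `^ (1 - 1) * (s - 0) `^ (al - 1))).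
    by apply: integrableS ib => //; exact: subset_itv_oo_cc.
  by apply: eq_integrable ib' => // s _ /=; rewrite subrr powRr0 mul1r.
Unshelve. all: by end_near. Qed.

(** * First hitting times and comparison of sub- and supersolutions *)

Lemma within_itv_near (R : realType) (f : R -> R) (a b : R) :
  {within `[a, b], continuous f} -> forall x e, a <= x <= b -> 0 < e ->
  exists2 d, 0 < d & forall y, a <= y <= b -> `|x - y| < d -> `|f x - f y| < e.
Proof.
move=> /subspace_continuousP cf x e xab e0.
have /cvgrPdist_lt/(_ e e0)[d /= d0 Hd] := cf x (xab : x \in `[a, b]).
by exists d => // y yab xy; exact: Hd.
Qed.

(** The hitting time is the infimum of the times at which f is at least m. *)
Lemma first_hitting (R : realType) (f : R -> R) (T m : R) :
  0 <= T -> {within `[0, T], continuous f} -> f 0 < m -> m <= f T ->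
  exists t : R, [/\ 0 < t <= T, f t = m & forall s, 0 <= s <= t -> f s <= m].
Proof.
move=> T0 cf f0 fT.
pose S := [set s : R | 0 <= s <= T /\ m <= f s].
have ST : S T by split; rewrite ?T0 ?lexx.
have lS : lbound S 0 by move=> s [/andP[]].
have hS : has_inf S by split; [exists T|exists 0].
pose t := inf S.
have t0 : 0 <= t by apply: lb_le_inf => //; exists T.
have tT : t <= T by apply: ge_inf => //; exists 0.
have below s : 0 <= s -> s < t -> f s < m.
  move=> s0 st; rewrite ltNge; apply/negP => ms.
  have : t <= s; last by rewrite leNgt st.
  apply: ge_inf; first by exists 0.
  by split => //; rewrite s0/=; exact: le_trans (ltW st) tT.
have t0T : 0 <= t <= T by rewrite t0 tT.
have ft1 : m <= f t.
  rewrite leNgt; apply/negP; rewrite -subr_gt0 => ftm.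
  have [d d0 Hd] := within_itv_near cf t0T ftm.
  have [s Ss st] := inf_adherent d0 hS.
  have ts : t <= s by apply: ge_inf => //; exists 0.
  have : `|f t - f s| < m - f t.
    apply: Hd.
    - by case: Ss.
    - by rewrite ler0_norm ?subr_le0// opprB ltrBlDl.
  case: Ss => _ ms; rewrite ltr_norml => /andP[]; lra.
have t_gt0 : 0 < t.
  rewrite lt_neqAle t0 andbT; apply/eqP => t0'.
  by move: ft1; rewrite -t0' leNgt f0.
have ftm : f t = m.
  apply/eqP; rewrite eq_le ft1 andbT leNgt; apply/negP; rewrite -subr_gt0 => mft.
  have [d d0 Hd] := within_itv_near cf t0T mft.
  pose s := Num.max 0 (t - d / 2).
  have [s0 s1] : 0 <= s /\ t - d / 2 <= s by rewrite /s !le_max !lexx ?orbT.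
  have st : s < t by rewrite gt_max t_gt0 ltrBlDr ltrDl divr_gt0.
  have := below s s0 st.
  have : `|f t - f s| < f t - m.
    apply: Hd.
    - by rewrite s0/= (le_trans (ltW st)).
    - by rewrite gtr0_norm ?subr_gt0//; lra.
  by rewrite ltr_norml => /andP[]; lra.
exists t; split => //; first by rewrite t_gt0.
move=> s /andP[s0]; rewrite le_eqVlt => /predU1P[->|st]; first by rewrite ftm.
exact: ltW (below s s0 st).
Qed.

Lemma within_itv_sub (R : realType) (x y : R -> R) (T : R) :
  {within `[0, T], continuous x} -> {within `[0, T], continuous y} ->
  {within `[0, T], continuous (fun s => x s - y s)}.
Proof. by move=> cx cy z; apply: cvgB; [exact: cx|exact: cy]. Qed.

Lemma frac_regular_le (R : realType) (x : R -> R) (s t : R) : s <= t ->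
  frac_regular x t -> frac_regular x s.
Proof.
move=> st [h i]; split; first by move=> u /andP[u0 us]; apply: h; rewrite u0 (le_trans us).
by apply: integrableS i => //; apply: subset_itvl; rewrite bnd_simp.
Qed.

(** At a maximum of x - w where x > w, the extremum principle orders the Caputo
    derivatives as x and w are, while strict monotonicity of f orders them the
    other way. *)
Lemma comparison (R : realType) (al del T : R) (f x w : R -> R) :
  0 < al <= 1 -> 0 < T ->
  (forall u v, `|u| <= del -> `|v| <= del -> u < v -> f v < f u) ->
  {within `[0, T], continuous x} -> {within `[0, T], continuous w} ->
  frac_regular x T -> frac_regular w T ->
  (forall t, 0 <= t <= T -> `|x t| <= del /\ `|w t| <= del) ->
  (forall t, 0 < t <= T -> caputo al x t <= f (x t)) ->
  (forall t, 0 < t <= T -> f (w t) <= caputo al w t) ->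
  x 0 <= w 0 -> x T <= w T.
Proof.
move=> al01 T0 fdec cx cw rx rw xw xsub wsup x0w0; rewrite leNgt; apply/negP => wx.
have [t + tmax] := EVT_max (ltW T0) (within_itv_sub cx cw).
rewrite in_itv/= => /andP[t0 tT].
have wxt : w t < x t.
  rewrite -subr_gt0 (lt_le_trans _ (tmax T _))// ?subr_gt0//.
  by rewrite in_itv/= lexx (ltW T0).
have t_gt0 : 0 < t.
  rewrite lt_neqAle t0 andbT; apply/eqP => t0'.
  by move: wxt; rewrite -t0' ltNge x0w0.
have tT' : 0 < t <= T by rewrite t_gt0.
have := caputo_touch al01 t_gt0 (frac_regular_le tT rx) (frac_regular_le tT rw).
have H s : 0 < s <= t -> x s - w s <= x t - w t.
  by move=> /andP[s0 st]; apply: tmax; rewrite in_itv/= (ltW s0) (le_trans st).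
move=> /(_ H) cle.
have [|xd wd] := xw t; first by rewrite t0.
have := fdec _ _ wd xd wxt.
by rewrite ltNge (le_trans (wsup t tT'))// (le_trans cle)// xsub.
Qed.

Lemma frac_regular_cst (R : realType) (c T : R) : 0 < T ->
  frac_regular (cst c) T.
Proof.
move=> T0.
have h1 (s : R) : 0 < s -> is_derive s 1 (cst c : R -> R) (cst 0 s).
  by move=> _; exact: is_derive_cst.
have h2 (s : R) : 0 < s -> {for s, continuous (cst 0 : R -> R)}.
  by move=> _; exact: cvg_cst.
have h3 (s : R) : 0 < s < T -> `|(cst 0 s : R)| <= 0 * s `^ (1 - 1).
  by rewrite mul0r normr0.
by have [] := frac_regular_of ltr01 h1 h2 T0 h3.
Qed.

Lemma caputo_cst (R : realType) (al c t : R) : 0 < al <= 1 -> 0 < t ->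
  caputo al (cst c) t = 0.
Proof.
move=> al01 t0; have r := frac_regular_cst c t0.
have d0 s : (cst c : R -> R)^`()%classic s = 0 by rewrite derive1_cst.
apply/eqP; rewrite eq_le; apply/andP; split.
- rewrite -[leRHS](mul0r (caputo_unit al)).
  by apply: caputo_le_power => // s _; rewrite d0 mul0r.
- rewrite -[leLHS](mul0r (caputo_unit al)).
  by apply: caputo_ge_power => // s _; rewrite d0 mul0r.
Qed.

(** A solution that leaves the ball of radius m first reaches some radius m'
    between m and del; up to then it lies between the constants - m and m by
    comparison.  The equation is only assumed as long as x has stayed in the
    ball of radius del, so that the lemma applies to the solutions of the
    truncated equation. *)
Lemma bounded_by_initial (R : realType) (al del m T : R) (f x : R -> R) :
  0 < al <= 1 -> f 0 = 0 ->
  (forall u v, `|u| <= del -> `|v| <= del -> u < v -> f v < f u) ->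
  {within `[0, T], continuous x} ->
  (0 < T -> frac_regular x T) ->
  (forall t, 0 < t <= T -> (forall s, 0 <= s <= t -> `|x s| <= del) ->
    caputo al x t = f (x t)) ->
  0 <= m -> m < del -> `|x 0| <= m ->
  forall t, 0 <= t <= T -> `|x t| <= m.
Proof.
move=> al01 f0 fdec cx rx xeq m0 mdel x0m t /andP[t0 tT].
rewrite leNgt; apply/negP => mxt.
pose m' := Num.min `|x t| del.
have mm' : m < m' by rewrite lt_min mxt.
have cn : {within `[0, t], continuous (fun s => `|x s|)}.
  have cxt : {within `[0, t], continuous x}.
    by apply: continuous_subspaceW cx; apply: subset_itvl; rewrite bnd_simp.
  by move=> s; apply: continuous_comp; [exact: cxt|exact: norm_continuous].
have [|t1 [/andP[t10 t1t] xt1 Ht1]] := first_hitting t0 cn (le_lt_trans x0m mm').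
  by rewrite /m' ge_min lexx.
have t1T : t1 <= T by exact: le_trans tT.
have cx1 : {within `[0, t1], continuous x}.
  by apply: continuous_subspaceW cx; apply: subset_itvl; rewrite bnd_simp.
have rx1 : frac_regular x t1 by apply: frac_regular_le (rx _) => //; exact: lt_le_trans t1T.
have xd s : 0 <= s <= t1 -> `|x s| <= del.
  by move=> /Ht1 /le_trans; apply; rewrite /m' ge_min lexx orbT.
have xeq1 s : 0 < s <= t1 -> caputo al x s = f (x s).
  move=> /andP[s0 st]; apply: xeq; first by rewrite s0 (le_trans st).
  by move=> u /andP[u0 us]; apply: xd; rewrite u0 (le_trans us).
have cc c : {within `[0, t1], continuous (cst c : R -> R)}.
  by apply: continuous_within_of => s _; exact: cst_continuous.
have fm : f m <= 0.
  move: m0; rewrite le_eqVlt => /predU1P[<-|m0]; first by rewrite f0.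
  by rewrite -f0 ltW// fdec// ?normr0 ?gtr0_norm ?ltW//; exact: lt_trans mdel.
have fNm : 0 <= f (- m).
  move: m0; rewrite le_eqVlt => /predU1P[<-|m0]; first by rewrite oppr0 f0.
  by rewrite -f0 ltW// fdec// ?normrN ?normr0 ?gtr0_norm ?ltW ?oppr_lt0//; exact: lt_trans mdel.
have nm : `|m| <= del by rewrite ger0_norm// ltW.
move: x0m; rewrite ler_norml => /andP[x0m1 x0m2].
have le1 : x t1 <= m.
  apply: (@comparison _ al del t1 f x (cst m)) => //.
  - exact: frac_regular_cst.
  - by move=> s st; split; [exact: xd|].
  - by move=> s st; rewrite xeq1.
  - by move=> s /andP[s0 st]; rewrite caputo_cst.
have le2 : - m <= x t1.
  apply: (@comparison _ al del t1 f (cst (- m)) x) => //.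
  - exact: frac_regular_cst.
  - by move=> s st; split; [rewrite /= normrN|exact: xd].
  - by move=> s /andP[s0 st]; rewrite caputo_cst.
  - by move=> s st; rewrite xeq1.
have : `|x t1| <= m by rewrite ler_norml le1 le2.
by rewrite xt1 leNgt mm'.
Qed.

(** * A fixed point theorem with exponential weights *)

Lemma geometric_small (R : realType) (D e : R) : 0 < e ->
  exists n : nat, D * 2^-1 ^+ n < e.
Proof.
move=> e0.
have h : `|2^-1 : R| < 1 by rewrite ger0_norm ?invr_ge0// invf_lt1 ?ltr1n.
have /cvgrPdist_lt/(_ e e0) := cvg_geometric D h.
move=> [n _ /(_ n (leqnn n))]; rewrite /geometric/= sub0r normrN => /(le_lt_trans (ler_norm _)) ?.
by exists n.
Qed.

Lemma geometric_increments (R : realType) (u : nat -> R) (D : R) :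
  (forall n, `|u n.+1 - u n| <= D * 2^-1 ^+ n) ->
  exists2 l, u n @[n --> \oo] --> l & forall n, `|l - u n| <= 2 * D * 2^-1 ^+ n.
Proof.
move=> uD.
have D0 : 0 <= D by have := le_trans (normr_ge0 _) (uD 0%N); rewrite expr0 mulr1.
have step n j : `|u (n + j)%N - u n| <= 2 * D * 2^-1 ^+ n * (1 - 2^-1 ^+ j).
  elim: j => [|j IH]; first by rewrite addn0 subrr normr0 expr0 subrr mulr0.
  rewrite addnS -(subrK (u (n + j)%N) (u _.+1)) -addrA.
  apply: le_trans (ler_normD _ _) _.
  apply: le_trans (lerD (uD _) IH) _.
  by rewrite exprD exprS le_eqVlt; apply/orP; left; apply/eqP; field.
have tail n m : (n <= m)%N -> `|u m - u n| <= 2 * D * 2^-1 ^+ n.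
  move=> nm; rewrite -(subnKC nm); apply: le_trans (step _ _) _.
  rewrite ler_piMr ?mulr_ge0 ?exprn_ge0 ?invr_ge0// gerBl exprn_ge0// invr_ge0//.
have cu : cvg (u n @[n --> \oo]).
  apply: R_complete; apply: cauchy_exP => e e0.
  have [n Hn] := geometric_small (2 * D) e0.
  exists (u n); exists n => // m /= nm; rewrite /ball/=.
  by rewrite distrC; apply: le_lt_trans (tail _ _ nm) Hn.
exists (lim (u n @[n --> \oo])) => // n.
have h : `|u m - u n| @[m --> \oo] --> `|lim (u n @[n --> \oo]) - u n|.
  by apply: cvg_norm; apply: cvgB => //; exact: cvg_cst.
apply: (cvgr_to_le h); exists n => // m /= nm; exact: tail.
Qed.

(** Picard iteration on all of R at once: on every [- N, N] the iterates stay in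
    a ball and contract by 1/2 for weights expR (M `|t|) that may depend on N.
    So they converge locally uniformly, at a geometric rate. *)
Lemma picard_fixpoint (R : realType) (Phi : (R -> R) -> (R -> R)) :
  (forall w, continuous w -> continuous (Phi w)) ->
  (forall N : R, 0 <= N -> exists V M1 M2 : R,
    [/\ [/\ 0 <= V, 0 <= M1 & 0 <= M2],
      (forall w, continuous w ->
         (forall t, `|t| <= N -> `|w t| <= V * expR (M1 * `|t|)) ->
         forall t, `|t| <= N -> `|Phi w t| <= V * expR (M1 * `|t|)) &
      (forall w1 w2, continuous w1 -> continuous w2 ->
         (forall t, `|t| <= N -> `|w1 t| <= V * expR (M1 * `|t|)) ->
         (forall t, `|t| <= N -> `|w2 t| <= V * expR (M1 * `|t|)) ->
         forall C, 0 <= C ->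
         (forall t, `|t| <= N -> `|w1 t - w2 t| <= C * expR (M2 * `|t|)) ->
         forall t, `|t| <= N -> `|Phi w1 t - Phi w2 t| <= C / 2 * expR (M2 * `|t|))]) ->
  exists2 w, continuous w & forall t, Phi w t = w t.
Proof.
move=> Phic PhiN.
pose w_ n := iter n Phi (fun _ => 0).
have cw n : continuous (w_ n).
  by elim: n => [|n IH]; [move=> x; exact: cst_continuous|exact: Phic].
have key N : 0 <= N -> exists V M1 M2 D : R,
  [/\ [/\ 0 <= V, 0 <= M1 & 0 <= M2],
   (forall n t, `|t| <= N -> `|w_ n t| <= V * expR (M1 * `|t|)),
   (forall n t, `|t| <= N -> `|w_ n.+1 t - w_ n t| <= D * 2^-1 ^+ n) &
   (forall w1 w2, continuous w1 -> continuous w2 ->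
         (forall t, `|t| <= N -> `|w1 t| <= V * expR (M1 * `|t|)) ->
         (forall t, `|t| <= N -> `|w2 t| <= V * expR (M1 * `|t|)) ->
         forall C, 0 <= C ->
         (forall t, `|t| <= N -> `|w1 t - w2 t| <= C * expR (M2 * `|t|)) ->
         forall t, `|t| <= N -> `|Phi w1 t - Phi w2 t| <= C / 2 * expR (M2 * `|t|))].
  move=> N0; have [V [M1 [M2 [[V0 M10 M20] H1 H2]]]] := PhiN N N0.
  have Hb n t : `|t| <= N -> `|w_ n t| <= V * expR (M1 * `|t|).
    elim: n t => [|n IH] t tN; first by rewrite normr0 mulr_ge0 ?expR_ge0.
    exact: H1.
  pose C0 := V * expR (M1 * N).
  have C00 : 0 <= C0 by rewrite mulr_ge0 ?expR_ge0.
  have Hd n t : `|t| <= N -> `|w_ n.+1 t - w_ n t| <= C0 * 2^-1 ^+ n * expR (M2 * `|t|).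
    elim: n t => [|n IH] t tN.
      rewrite subr0 expr0 mulr1 (le_trans (Hb _ _ tN))//.
      apply: (@le_trans _ _ C0); first by rewrite ler_wpM2l// ler_expR ler_wpM2l.
      by rewrite ler_peMr// -expR0 ler_expR mulr_ge0.
    have := H2 _ _ (cw n.+1) (cw n) (Hb _) (Hb _) _ _ IH t tN.
    rewrite exprSr mulrA; apply; rewrite mulr_ge0// exprn_ge0// invr_ge0//.
  exists V, M1, M2, (C0 * expR (M2 * N)); split => // n t tN.
  apply: le_trans (Hd n t tN) _; rewrite mulrAC ler_wpM2r ?exprn_ge0 ?invr_ge0//.
  by rewrite ler_wpM2l// ler_expR ler_wpM2l.
have [w Hw] : {w : R -> R & forall t, w_ n t @[n --> \oo] --> w t}.
  have H t : exists l : R, w_ n t @[n --> \oo] --> l.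
    have [V [M1 [M2 [D [_ _ HD _]]]]] := key `|t| (normr_ge0 t).
    have [l Hl _] := geometric_increments (fun n => HD n t (lexx _)).
    by exists l.
  by exists (fun t => projT1 (cid (H t))) => t; exact: (projT2 (cid (H t))).
have tail N (D : R) : (forall n t, `|t| <= N -> `|w_ n.+1 t - w_ n t| <= D * 2^-1 ^+ n) ->
    forall n t, `|t| <= N -> `|w t - w_ n t| <= 2 * D * 2^-1 ^+ n.
  move=> HD n t tN; have [l Hl Hl2] := geometric_increments (fun n => HD n t tN).
  by rewrite (cvg_unique _ (Hw t) Hl).
have cwl : continuous w.
  move=> t; apply/cvgrPdist_lt => e e0.
  have N0 : 0 <= `|t| + 1 by rewrite addr_ge0.
  have [V [M1 [M2 [D [_ _ HD _]]]]] := key _ N0.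
  have e3 : 0 < e / 3 by rewrite divr_gt0.
  have [n Hn] := geometric_small (2 * D) e3.
  have := cw n t => /cvgrPdist_lt/(_ _ e3) near1.
  have near2 : \forall s \near t, `|s| <= `|t| + 1.
    exists 1 => //= s; rewrite /ball_/= => ts1.
    rewrite -(subrK t s) addrC (le_trans (ler_normD _ _))// lerD2l distrC.
    exact: ltW.
  near=> s.
  have h1 : `|w t - w_ n t| < e / 3.
    by apply: le_lt_trans (tail _ _ HD n t _) Hn; rewrite lerDl.
  have h2 : `|w s - w_ n s| < e / 3.
    by apply: le_lt_trans (tail _ _ HD n s _) Hn; near: s.
  have h3 : `|w_ n t - w_ n s| < e / 3 by near: s.
  move: h1 h2 h3; rewrite !ltr_norml => /andP[? ?] /andP[? ?] /andP[? ?].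
  by apply/andP; split; lra.
exists w => // t.
have [V [M1 [M2 [D [[V0 M10 M20] Hb HD HC]]]]] := key _ (normr_ge0 t).
have D0 : 0 <= D.
  have := HD 0%N t (lexx _); rewrite expr0 mulr1; exact: le_trans.
have wb s : `|s| <= `|t| -> `|w s| <= V * expR (M1 * `|s|).
  move=> st.
  have h : `|w_ n s| @[n --> \oo] --> `|w s| by apply: cvg_norm; exact: Hw.
  by apply: (cvgr_to_le h); apply: nearW => n; exact: Hb.
have step n : `|Phi w t - w_ n.+1 t| <= 2 * D * 2^-1 ^+ n / 2 * expR (M2 * `|t|).
  apply: (HC w (w_ n) cwl (cw n) wb (Hb n)) => //; first by rewrite !mulr_ge0// exprn_ge0// invr_ge0.
  move=> s st; apply: le_trans (tail _ _ HD n s st) _.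
  by rewrite ler_peMr ?mulr_ge0// ?exprn_ge0 ?invr_ge0// -expR0 ler_expR mulr_ge0.
apply/eqP; rewrite -subr_eq0 -normr_le0 leNgt; apply/negP => e0.
pose E := D * expR (M2 * `|t|) + D.
have [n Hn] := geometric_small E e0.
have := tail _ _ HD n.+1 t (lexx _).
have := step n; move: Hn; rewrite exprS.
have -> : Phi w t - w t = (Phi w t - w_ n.+1 t) - (w t - w_ n.+1 t) by ring.
move=> h1 h2 h3; have := ler_normB (Phi w t - w_ n.+1 t) (w t - w_ n.+1 t).
rewrite /E in h1.
have q1 : 2 * D * 2^-1 ^+ n / 2 * expR (M2 * `|t|) = D * expR (M2 * `|t|) * 2^-1 ^+ n by field.
have q2 : 2 * D * (2^-1 * 2^-1 ^+ n) = D * 2^-1 ^+ n by field.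
rewrite q1 in h2; rewrite q2 in h3; rewrite mulrDl in h1; lra.
Unshelve. all: by end_near. Qed.

(** * Averages of dilated functions against an integrable kernel *)

Lemma continuous_norm_powR (R : realType) (al : R) : 0 < al ->
  continuous (fun t : R => `|t| `^ al).
Proof.
move=> al0 t; have [->|t0] := eqVneq t 0.
  apply/cvgrPdist_lt => e e0; rewrite normr0 powR0 ?gt_eqF//.
  have [d d0 Hd] := powR_small al0 e0.
  exists d => //= s; rewrite /ball_/= !sub0r !normrN => sd.
  by rewrite ger0_norm ?powR_ge0// Hd// normr_ge0 ltW.
apply: (@continuous_comp_powR _ Num.norm); first by rewrite normr_gt0.
exact: norm_continuous.
Qed.

(** With k a power or beta kernel, Volterra integrals over [0, t] become such
    averages after the rescaling s = t u.  The domain being fixed, continuity in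
    t, also at 0, is plain dominated convergence. *)
Definition avg {R : realType} (k g : R -> R) (t : R) : R :=
  \int[mu]_(u in `[0, 1]) (k u * g (t * u)).

Lemma continuous_dilation (R : realType) (g : R -> R) (t : R) :
  continuous g -> continuous (fun u : R => g (t * u)).
Proof.
move=> cg u; apply: (@continuous_comp _ _ _ (fun u => t * u) g); last exact: cg.
by apply: cvgM; [exact: cvg_cst|exact: cvg_id].
Qed.

Lemma continuous_dilationl (R : realType) (g : R -> R) (u : R) :
  continuous g -> continuous (fun t : R => g (t * u)).
Proof.
move=> cg; rewrite (_ : (fun t => _) = (fun t => g (u * t))).
  exact: continuous_dilation.
by apply/funext => s; rewrite mulrC.
Qed.

Lemma continuous_bounded (R : realType) (g : R -> R) (N : R) : 0 <= N ->
  continuous g -> exists2 C, 0 <= C & forall t, `|t| <= N -> `|g t| <= C.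
Proof.
move=> N0 cg; have [||C C0 HC] := @continuous_itv_bounded R g (- N) N.
- by lra.
- by apply: continuous_within_of => x _; exact: cg.
by exists C => // t; rewrite ler_norml => tN; exact: HC.
Qed.

Lemma norm_dilation_le (R : realType) (t u N : R) : 0 <= u <= 1 -> `|t| <= N ->
  `|t * u| <= N.
Proof.
move=> /andP[u0 u1] tN; rewrite normrM (ger0_norm u0).
by rewrite (le_trans _ tN)// ler_piMr.
Qed.

Lemma avg_integrable (R : realType) (k g : R -> R) (t : R) :
  mu.-integrable (`[0, 1] : set R) (EFin \o k) -> continuous g ->
  mu.-integrable (`[0, 1] : set R) (EFin \o (fun u => k u * g (t * u))).
Proof.
move=> ik cg; have [C C0 HC] := continuous_bounded (normr_ge0 t) cg.
apply: (@LintegrableM_bounded _ _ _ _ C) => //.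
  by apply: measurable_fun_continuousT => //; exact: continuous_dilation.
move=> u /=; rewrite in_itv/= => u01; apply: HC; exact: norm_dilation_le.
Qed.

Lemma avg_norm_le (R : realType) (k g B : R -> R) (t : R) :
  mu.-integrable (`[0, 1] : set R) (EFin \o k) -> (forall u, 0 <= k u) ->
  continuous g ->
  mu.-integrable (`[0, 1] : set R) (EFin \o (fun u => k u * B u)) ->
  (forall u, 0 <= u <= 1 -> `|g (t * u)| <= B u) ->
  `|avg k g t| <= \int[mu]_(u in `[0, 1]) (k u * B u).
Proof.
move=> ik k0 cg ikB gB; have ig := avg_integrable t ik cg.
apply: le_trans (le_normr_Rintegral _ ig) _ => //.
apply: le_Rintegral => //; first exact: integrable_norm ig.
move=> u /=; rewrite in_itv/= => u01.
by rewrite normrM (ger0_norm (k0 u)) ler_wpM2l// gB.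
Qed.

Lemma avgB (R : realType) (k g1 g2 : R -> R) (t : R) :
  mu.-integrable (`[0, 1] : set R) (EFin \o k) -> continuous g1 -> continuous g2 ->
  avg k g1 t - avg k g2 t = avg k (fun s => g1 s - g2 s) t.
Proof.
move=> ik cg1 cg2; rewrite /avg -RintegralB//; [|exact: avg_integrable..].
by apply: eq_Rintegral => u _; ring.
Qed.

(** On a bounded range of t, the integrand is dominated by a multiple of the
    integrable kernel. *)
Lemma avg_continuous (R : realType) (k g : R -> R) :
  mu.-integrable (`[0, 1] : set R) (EFin \o k) -> (forall u, 0 <= k u) ->
  continuous g -> continuous (avg k g).
Proof.
move=> ik k0 cg t.
have N0 : 0 <= `|t| + 1 by rewrite addr_ge0.
have [C C0 HC] := continuous_bounded N0 cg.
have It : t \in (`](- (`|t| + 1)), (`|t| + 1)[%classic : set R).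
  by rewrite inE/= in_itv/= -ltr_norml ltrDl.
apply: (@continuity_under_integral R _ _ mu (fun l u => k u * g (l * u)) `[0, 1]
   _ (- (`|t| + 1)) (`|t| + 1) _ _ (fun u => C * k u) _ _ t It) => //.
- by move=> x _; exact: avg_integrable.
- apply: aeW => u _ l _; apply: cvgM; first exact: cvg_cst.
  exact: (continuous_dilationl cg).
- exact: LintegrableZ.
- move=> x /=; rewrite in_itv/= -ltr_norml => xN; apply: aeW => u/=.
  rewrite in_itv/= => u01; rewrite normrM (ger0_norm (k0 u)) mulrC ler_wpM2r//.
  by apply: HC; apply: norm_dilation_le => //; exact: ltW.
Qed.

(** Used to trade an exponential weight for a power of its rate M; the exponent
    - q is kept above - al so that the product with the kernel stays
    integrable. *)
Lemma expRN_le_powR (R : realType) (q z : R) : 0 < q <= 1 -> 0 < z ->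
  expR (- z) <= z `^ (- q).
Proof.
move=> /andP[q0 q1] z0; rewrite expRN powRN lef_pV2 ?posrE ?expR_gt0 ?powR_gt0//.
have [z1|z1] := leP z 1.
  rewrite (@le_trans _ _ 1)//; last by rewrite -expR0 ler_expR ltW.
  by have := le_powR_nonneg (ltW q0) (ltW z0) z1; rewrite powR1.
rewrite (le_trans (ler1_powR (ltW z1) q1))//.
by rewrite (le_trans _ (expR_ge1Dx _))// lerDr.
Qed.

(** The Volterra operator gains a small factor in the weight expR (M `|t|):
    since expR (- M t (1 - u)) is at most (M t (1 - u)) `^ (- (al / 2)), the
    integral is a Beta integral times M `^ (- (al / 2)), and a large rate M
    makes this small. *)
Lemma beta_weight (R : realType) (al N K : R) : 0 < al <= 1 -> 0 <= N -> 0 <= K ->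
  exists2 M : R, 0 <= M & forall t, `|t| <= N ->
    K * (`|t| `^ al * \int[mu]_(u in `[0, 1])
      (beta_kernel al al u * expR (M * `|t * u|))) <= 2^-1 * expR (M * `|t|).
Proof.
move=> /andP[al0 al1] N0 K0.
have a20 : 0 < al / 2 by rewrite divr_gt0.
pose B := Beta (al / 2) al.
have B0 : 0 < B by apply: Beta_gt0; apply/andP; split; lra.
(* The rate M is chosen so that M `^ (al / 2) = c. *)
pose c := 2 * K * N `^ (al / 2) * B + 1.
have c0 : 0 < c.
  by rewrite ltr_wpDl// mulr_ge0 ?(ltW B0)// mulr_ge0 ?powR_ge0// mulr_ge0.
pose M := c `^ (al / 2)^-1.
have M0 : 0 < M by rewrite powR_gt0.
have Mc : M `^ (al / 2) = c by rewrite -powRrM mulVf ?powRr1 ?gt_eqF// ltW.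
exists M; first exact: ltW.
move=> t tN; have [->|t0] := eqVneq t 0.
  by rewrite normr0 powR0 ?gt_eqF// mul0r mulr0 mulr_ge0 ?expR_ge0// invr_ge0.
have {}t0 : 0 < `|t| by rewrite normr_gt0.
have ib := integrable_beta_kernel al0 al0.
have ib2 := integrable_beta_kernel a20 al0.
pose D := expR (M * `|t|) * (M * `|t|) `^ (- (al / 2)).
have cE : continuous (fun s : R => expR (M * `|s|)).
  move=> s; apply: continuous_comp; last exact: continuous_expR.
  by apply: cvgM; [exact: cvg_cst|exact: norm_continuous].
have ie := avg_integrable t ib cE.
have le1 : \int[mu]_(u in `[0, 1]) (beta_kernel al al u * expR (M * `|t * u|)) <= D * B.
  (* At u = 1 the exponential bound fails: a negative power of 0 is 0. *)
  have ie' : mu.-integrable (`[0, 1[ : set R)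
      (EFin \o (fun u => beta_kernel al al u * expR (M * `|t * u|))).
    by apply: integrableS ie => //; apply: subset_itvl; rewrite bnd_simp.
  have ib2' : mu.-integrable (`[0, 1[ : set R) (EFin \o beta_kernel (al / 2) al).
    by apply: integrableS ib2 => //; apply: subset_itvl; rewrite bnd_simp.
  rewrite -(Rintegral_itv_bndo_bndc ie') /B /Beta -(Rintegral_itv_bndo_bndc ib2').
  rewrite -RintegralZl//; apply: le_Rintegral => //; first exact: LintegrableZ.
  move=> u /=; rewrite in_itv/= => /andP[u0 u1].
  have z0 : 0 < M * `|t| * (1 - u) by rewrite !mulr_gt0// subr_gt0.
  have -> : M * `|t * u| = M * `|t| + - (M * `|t| * (1 - u)).
    by rewrite normrM (ger0_norm u0); ring.
  rewrite expRD.
  have a2 : 0 < al / 2 <= 1 by apply/andP; split; lra.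
  have := expRN_le_powR a2 z0.
  rewrite powRM ?subr_ge0 ?(ltW u1)//; last by rewrite mulr_ge0 ?normr_ge0 ?(ltW M0).
  move=> h; rewrite /D /beta_kernel.
  have -> : (1 - u) `^ (al / 2 - 1) = (1 - u) `^ (al - 1) * (1 - u) `^ (- (al / 2)).
    rewrite -powRD; first by congr (_ `^ _); field.
    by rewrite (gt_eqF (_ : 0 < 1 - u)) ?implybT// subr_gt0.
  set a := expR (M * `|t|); set b := (1 - u) `^ (al - 1); set e := u `^ _.
  have a0 : 0 <= a by exact: expR_ge0.
  have b0 : 0 <= b by exact: powR_ge0.
  have e0 : 0 <= e by exact: powR_ge0.
  rewrite (_ : b * e * (a * _) = (b * e * a) * expR (- (M * `|t| * (1 - u)))); last by ring.
  apply: le_trans (ler_wpM2l _ h) _; first by rewrite !mulr_ge0.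
  by rewrite le_eqVlt; apply/orP; left; apply/eqP; ring.
apply: (@le_trans _ _ (K * (`|t| `^ al * (D * B)))).
  by rewrite ler_wpM2l// ler_wpM2l// powR_ge0.
rewrite /D powRM ?(ltW M0)// (powRN M) Mc.
have E : `|t| `^ al * `|t| `^ (- (al / 2)) = `|t| `^ (al / 2).
  rewrite -powRD; first by congr (_ `^ _); field.
  by rewrite (gt_eqF t0) implybT.
rewrite (_ : K * _ = (K * (`|t| `^ al * `|t| `^ (- (al / 2))) * B / c) * expR (M * `|t|)); last first.
  by field; rewrite gt_eqF.
rewrite E ler_wpM2r ?expR_ge0// ler_pdivrMr//.
apply: (@le_trans _ _ (K * N `^ (al / 2) * B)).
  rewrite ler_wpM2r ?(ltW B0)// ler_wpM2l//.
  by apply: le_powR_nonneg => //; exact: ltW.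
by rewrite /c; lra.
Qed.

(** * The Picard operator for the derivative of the solution *)

(** The integral of s `^ (al - 1) g(s) over [0, t] ([power_primitiveE]), in the
    rescaled form that is continuous at 0 and makes sense for every real t. *)
Definition power_primitive {R : realType} (al : R) (g : R -> R) (t : R) : R :=
  `|t| `^ al * avg (fun u => u `^ (al - 1)) g t.

Lemma power_primitive0 (R : realType) (al : R) (g : R -> R) : 0 < al ->
  power_primitive al g 0 = 0.
Proof. by move=> al0; rewrite /power_primitive normr0 powR0 ?mul0r// gt_eqF. Qed.

Lemma power_primitive_continuous (R : realType) (al : R) (g : R -> R) : 0 < al ->
  continuous g -> continuous (power_primitive al g).
Proof.
move=> al0 cg t; apply: cvgM; first exact: continuous_norm_powR.
apply: avg_continuous => //; first exact: integrable_powR01.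
by move=> u; exact: powR_ge0.
Qed.

Lemma integrable_powR_itv (R : realType) (al t : R) (g : R -> R) : 0 < al -> 0 < t ->
  continuous g -> mu.-integrable `[0, t] (EFin \o (fun s => s `^ (al - 1) * g s)).
Proof.
move=> al0 t0 cg; have [C C0 HC] := continuous_bounded (ltW t0) cg.
apply: (@LintegrableM_bounded _ _ _ _ C) => //.
- exact: measurable_fun_continuousT.
- move=> s /=; rewrite in_itv/= => /andP[s0 st]; apply: HC.
  by rewrite ger0_norm.
- have ib := integrable_beta_itv ltr01 al0 t0.
  by apply: eq_integrable ib => // s _ /=; rewrite subrr powRr0 mul1r subr0.
Qed.

Lemma power_primitiveE (R : realType) (al t : R) (g : R -> R) : 0 < al -> 0 < t ->
  continuous g ->
  power_primitive al g t = \int[mu]_(s in `[0, t]) (s `^ (al - 1) * g s).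
Proof.
move=> al0 t0 cg; rewrite Rintegral_rescale//; last exact: integrable_powR_itv.
rewrite subr0 /power_primitive gtr0_norm//.
have -> : t `^ al = t * t `^ (al - 1) by rewrite mulr_powRB1// ltW.
rewrite -mulrA; congr (_ * _); rewrite /avg -RintegralZl//; last first.
  by apply: avg_integrable => //; exact: integrable_powR01.
apply: eq_Rintegral => u /set_mem/=; rewrite in_itv/= => /andP[u0 u1].
by rewrite add0r powRM ?(ltW t0)// mulrA.
Qed.

(** The integral form is available on a neighbourhood of t, where it has this
    derivative by continuity of g. *)
Lemma power_primitive_derive (R : realType) (al t : R) (g : R -> R) : 0 < al -> 0 < t ->
  continuous g -> is_derive t 1 (power_primitive al g) (t `^ (al - 1) * g t).
Proof.
move=> al0 t0 cg.
have tt : t < t + 1 by rewrite ltrDl.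
have t10 : 0 < t + 1 by rewrite (lt_trans t0).
have ii := integrable_powR_itv al0 t10 cg.
have cf : {for t, continuous (fun s => s `^ (al - 1) * g s)}.
  by apply: cvgM; [exact: continuous_powR_gt0|exact: cg].
have [d1 d2] := continuous_FTC1_closed tt ii t0 cf.
have near_eq : {near t, (fun x => \int[mu]_(s in `[0, x]) (s `^ (al - 1) * g s)) =1
    power_primitive al g}.
  near=> x; rewrite power_primitiveE//; near: x; exact: lt_nbhsr.
apply: DeriveDef; first exact: near_eq_derivable near_eq d1.
by rewrite -(@near_eq_derive _ _ _ _ _ t 1 near_eq) -derive1E.
Unshelve. all: by end_near. Qed.

(** For kap = 1 / caputo_unit al and c0 = kap f(x0), a fixed point w gives the
    solution y = x0 + power_primitive al w.  This is the equation obtained by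
    differentiating the Volterra equation y = x0 + I^al f(y), for y' = t `^ (al
    - 1) w, with h in place of f' and after the rescaling r = t u. *)
Definition picard_op {R : realType} (al kap c0 x0 : R) (h : R -> R) (w : R -> R)
    (t : R) : R :=
  c0 + kap * (`|t| `^ al *
    avg (beta_kernel al al) (fun s => h (x0 + power_primitive al w s) * w s) t).

Lemma picard_integrand_continuous (R : realType) (al x0 : R) (h w : R -> R) :
  0 < al -> continuous h -> continuous w ->
  continuous (fun s => h (x0 + power_primitive al w s) * w s).
Proof.
move=> al0 ch cw t; apply: cvgM; last exact: cw.
apply: (@continuous_comp _ _ _ (fun s => x0 + power_primitive al w s) h); last exact: ch.
by apply: cvgD; [exact: cvg_cst|exact: power_primitive_continuous].
Qed.

Lemma lipschitz_continuous (R : realType) (h : R -> R) (L : R) :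
  (forall u v, `|h u - h v| <= L * `|u - v|) -> continuous h.
Proof.
move=> hL t; apply/cvgrPdist_lt => e e0.
have L1 : 0 < `|L| + 1 by rewrite ltr_wpDl.
exists (e / (`|L| + 1)); first by rewrite /= divr_gt0.
move=> s; rewrite /ball_/= => ts; apply: le_lt_trans (hL _ _) _.
apply: (@le_lt_trans _ _ ((`|L| + 1) * `|t - s|)).
  by rewrite ler_wpM2r// (le_trans (ler_norm _))// lerDl.
by rewrite mulrC -ltr_pdivlMr.
Qed.

Lemma avg_weight_le (R : realType) (k g : R -> R) (M C N t : R) :
  mu.-integrable (`[0, 1] : set R) (EFin \o k) -> (forall u, 0 <= k u) ->
  continuous g -> `|t| <= N ->
  (forall s, `|s| <= N -> `|g s| <= C * expR (M * `|s|)) ->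
  `|avg k g t| <= C * \int[mu]_(u in `[0, 1]) (k u * expR (M * `|t * u|)).
Proof.
move=> ik k0 cg tN gB.
have cE : continuous (fun s : R => expR (M * `|s|)).
  move=> s; apply: continuous_comp; last exact: continuous_expR.
  by apply: cvgM; [exact: cvg_cst|exact: norm_continuous].
have ie := avg_integrable t ik cE.
have E : (fun u => k u * (C * expR (M * `|t * u|))) =
    (fun u => C * (k u * expR (M * `|t * u|))) by apply/funext => u; ring.
have := @avg_norm_le _ k g (fun u => C * expR (M * `|t * u|)) t ik k0 cg.
rewrite E RintegralZl//; apply; first exact: LintegrableZ.
by move=> u u01; apply: gB; exact: norm_dilation_le.
Qed.

Lemma power_primitive_weight (R : realType) (al N M C : R) (g : R -> R) (t : R) :
  0 < al -> 0 <= M -> 0 <= C -> continuous g -> `|t| <= N ->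
  (forall s, `|s| <= N -> `|g s| <= C * expR (M * `|s|)) ->
  `|power_primitive al g t| <=
    N `^ al * \int[mu]_(u in `[0, 1]) (u `^ (al - 1)) * C * expR (M * `|t|).
Proof.
move=> al0 M0 C0 cg tN gB.
have ip := integrable_powR01 al0.
rewrite normrM (ger0_norm (powR_ge0 _ _)) -!mulrA.
apply: ler_pM => //; rewrite ?powR_ge0//.
  by apply: le_powR_nonneg => //; exact: ltW.
have := @avg_norm_le _ (fun u => u `^ (al - 1)) g (fun u => C * expR (M * `|t|)) t ip
   (fun u => powR_ge0 _ _) cg.
rewrite RintegralZr//; apply.
  by have := LintegrableZ (C * expR (M * `|t|)) (measurable_itv _) ip;
    apply: eq_integrable => // u _ /=; rewrite mulrC.
move=> u /andP[u0 u1]; apply: le_trans (gB _ _) _.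
  by apply: norm_dilation_le => //; rewrite u0.
rewrite ler_wpM2l// ler_expR ler_wpM2l// normrM (ger0_norm u0).
by rewrite ler_piMr.
Qed.

(** Boundedness of h keeps the iterates in a ball of radius 2 `|c0| for one
    weight; this makes the product h(y) w Lipschitz in w on [- N, N], and a
    second, larger rate then makes the operator a contraction. *)
Lemma picard_solution (R : realType) (al kap c0 x0 H L : R) (h : R -> R) :
  0 < al <= 1 -> 0 < kap -> 0 <= H -> 0 <= L ->
  (forall u, `|h u| <= H) -> (forall u v, `|h u - h v| <= L * `|u - v|) ->
  exists2 w : R -> R, continuous w & forall t, picard_op al kap c0 x0 h w t = w t.
Proof.
move=> al01 kap0 H0 L0 hH hL; have /andP[al0 al1] := al01.
have ch := lipschitz_continuous hL.
have ib := integrable_beta_kernel al0 al0.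
have b0 := beta_kernel_ge0 al al.
apply: picard_fixpoint.
  move=> w cw t; apply: cvgD; first exact: cvg_cst.
  apply: cvgM; first exact: cvg_cst.
  apply: cvgM; first exact: continuous_norm_powR.
  by apply: avg_continuous => //; exact: picard_integrand_continuous.
move=> N N0.
have [M1 M10 HM1] := beta_weight al01 N0 (mulr_ge0 (ltW kap0) H0).
(* Half of V pays for c0, the other half for the contracting integral. *)
pose V := 2 * `|c0|.
have V0 : 0 <= V by rewrite mulr_ge0.
pose VN := V * expR (M1 * N).
have VN0 : 0 <= VN by rewrite mulr_ge0 ?expR_ge0.
pose G := \int[mu]_(u in (`[0, 1] : set R)) (u `^ (al - 1)).
have G0 : 0 <= G by apply: Rintegral_ge0 => u _; exact: powR_ge0.
pose K' := H + L * (N `^ al * G) * VN.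
have K'0 : 0 <= K' by rewrite addr_ge0// !mulr_ge0// powR_ge0.
have [M2 M20 HM2] := beta_weight al01 N0 (mulr_ge0 (ltW kap0) K'0).
exists V, M1, M2; split => //.
- move=> w cw wB t tN; rewrite /picard_op.
  apply: le_trans (ler_normD _ _) _.
  rewrite normrM (gtr0_norm kap0) normrM (ger0_norm (powR_ge0 _ _)).
  have gB s : `|s| <= N -> `|h (x0 + power_primitive al w s) * w s| <= H * V * expR (M1 * `|s|).
    by move=> sN; rewrite normrM -mulrA; apply: ler_pM => //; exact: wB.
  have cg := @picard_integrand_continuous _ al x0 h _ al0 ch cw.
  have h1 := avg_weight_le ib b0 cg tN gB.
  have h2 := HM1 t tN.
  have E1 : 1 <= expR (M1 * `|t|) by rewrite -expR0 ler_expR mulr_ge0.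
  have h3 : kap * (`|t| `^ al * `|avg (beta_kernel al al)
     (fun s => h (x0 + power_primitive al w s) * w s) t|) <= V * (2^-1 * expR (M1 * `|t|)).
    apply: le_trans (ler_wpM2l V0 h2).
    set I := \int[mu]_(u in _) _ in h1 *.
    rewrite (_ : V * _ = kap * (`|t| `^ al * (H * V * I))); last by ring.
    by rewrite ler_wpM2l ?(ltW kap0)// ler_wpM2l// powR_ge0.
  apply: le_trans (lerD (lexx _) h3) _.
  have : `|c0| <= `|c0| * expR (M1 * `|t|) by rewrite ler_peMr.
  by rewrite /V; lra.
- move=> w1 w2 cw1 cw2 w1B w2B C C0 w12 t tN; rewrite /picard_op.
  have cg1 := @picard_integrand_continuous _ al x0 h _ al0 ch cw1.
  have cg2 := @picard_integrand_continuous _ al x0 h _ al0 ch cw2.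
  have cg : continuous (fun s => h (x0 + power_primitive al w1 s) * w1 s -
      h (x0 + power_primitive al w2 s) * w2 s).
    by move=> s; apply: cvgB; [exact: cg1|exact: cg2].
  have cw : continuous (fun s => w1 s - w2 s).
    by move=> s; apply: cvgB; [exact: cw1|exact: cw2].
  rewrite opprD addrACA subrr add0r -mulrBr -mulrBr avgB//.
  rewrite normrM (gtr0_norm kap0) normrM (ger0_norm (powR_ge0 _ _)).
  have gB s : `|s| <= N -> `|h (x0 + power_primitive al w1 s) * w1 s -
      h (x0 + power_primitive al w2 s) * w2 s| <= K' * C * expR (M2 * `|s|).
    move=> sN.
    have -> : h (x0 + power_primitive al w1 s) * w1 s - h (x0 + power_primitive al w2 s) * w2 s =
      h (x0 + power_primitive al w1 s) * (w1 s - w2 s) +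
      (h (x0 + power_primitive al w1 s) - h (x0 + power_primitive al w2 s)) * w2 s by ring.
    apply: le_trans (ler_normD _ _) _; rewrite !normrM /K' !mulrDl; apply: lerD.
      by rewrite -mulrA; apply: ler_pM => //; exact: w12.
    have p1 : `|power_primitive al w1 s - power_primitive al w2 s| <=
        N `^ al * G * C * expR (M2 * `|s|).
      have ip := integrable_powR01 al0.
      rewrite /power_primitive -mulrBr avgB//.
      exact: (@power_primitive_weight _ al N M2 C (fun s => w1 s - w2 s)).
    have p2 : `|h (x0 + power_primitive al w1 s) - h (x0 + power_primitive al w2 s)| <=
        L * (N `^ al * G * C * expR (M2 * `|s|)).
      apply: le_trans (hL _ _) _; rewrite ler_wpM2l//.
      by rewrite opprD addrACA subrr add0r.
    have p3 : `|w2 s| <= VN.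
      by apply: le_trans (w2B _ sN) _; rewrite /VN ler_wpM2l// ler_expR ler_wpM2l.
    apply: le_trans (ler_pM (normr_ge0 _) (normr_ge0 _) p2 p3) _.
    by rewrite le_eqVlt; apply/orP; left; apply/eqP; ring.
  have h1 := avg_weight_le ib b0 cg tN gB.
  have h2 := HM2 t tN.
  rewrite -[leRHS]mulrA; apply: le_trans (ler_wpM2l C0 h2).
  set I := \int[mu]_(u in _) _ in h1 *.
  rewrite (_ : C * _ = kap * (`|t| `^ al * (K' * C * I))); last by ring.
  by rewrite ler_wpM2l ?(ltW kap0)// ler_wpM2l// powR_ge0.
Qed.

(** * Abel's double integral *)

(** The integrand of Abel's double integral on the triangle 0 <= r <= s <= t,
    extended by 0. *)
Definition abel_integrand {R : realType} (p q t : R) (psi : R -> R)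
    (z : measurableTypeR R * measurableTypeR R) : \bar R :=
  (if [&& (0 <= z.2)%R, (z.2 <= z.1)%R & (z.1 <= t)%R] then
     (t - z.1) `^ (p - 1) * ((z.1 - z.2) `^ (q - 1) * psi z.2) else 0)%:E.

Lemma measurable_abel_integrand (R : realType) (p q t : R) (psi : R -> R) :
  measurable_fun [set: R] psi ->
  measurable_fun [set: measurableTypeR R * measurableTypeR R] (abel_integrand p q t psi).
Proof.
move=> mpsi.
have m1 : measurable_fun [set: measurableTypeR R * measurableTypeR R]
   (fun z => z.1 : R) by exact: measurable_fst.
have m2 : measurable_fun [set: measurableTypeR R * measurableTypeR R]
   (fun z => z.2 : R) by exact: measurable_snd.
have mp (f : measurableTypeR R * measurableTypeR R -> R) a :
    measurable_fun [set: measurableTypeR R * measurableTypeR R] f ->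
    measurable_fun [set: measurableTypeR R * measurableTypeR R] (fun z => f z `^ a).
  by move=> mf; apply: (@measurableT_comp _ _ _ _ _ _ (fun y : R => y `^ a)) => //; exact: measurable_powR.
apply/measurable_EFinP; apply: measurable_fun_ifT => //.
- apply: measurable_and; first exact: measurable_fun_ler.
  by apply: measurable_and; exact: measurable_fun_ler.
- apply: measurable_funM; first by apply: mp; exact: measurable_funB.
  apply: measurable_funM; first by apply: mp; exact: measurable_funB.
  exact: (measurableT_comp mpsi).
Qed.

Lemma abel_integrand_ge0 (R : realType) (p q t : R) (psi : R -> R) z :
  (forall r, 0 <= psi r) -> (0 <= abel_integrand p q t psi z)%E.
Proof.
move=> psi0; rewrite lee_fin; case: ifP => // _.
by rewrite !mulr_ge0 ?powR_ge0.
Qed.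

Lemma abel_inner1 (R : realType) (p q t s : R) (psi : R -> R) :
  measurable_fun [set: R] psi -> (forall r, 0 <= psi r) -> 0 <= s <= t ->
  (\int[mu]_r abel_integrand p q t psi (s, r) =
   ((t - s) `^ (p - 1))%:E *
     \int[mu]_(r in `[0%R, s]) ((s - r) `^ (q - 1) * psi r)%:E)%E.
Proof.
move=> mpsi psi0 /andP[s0 st].
have mm (D : set R) : measurable_fun D (fun r => (s - r) `^ (q - 1) * psi r).
  apply: measurable_funM; last exact: measurable_funTS.
  by apply: measurable_powR_comp; exact: measurable_funB.
rewrite -ge0_integralZl_EFin ?powR_ge0//; last 2 first.
- by move=> r _; rewrite lee_fin mulr_ge0 ?powR_ge0.
- by apply/measurable_EFinP; exact: mm.
rewrite [RHS]integral_mkcond; apply: eq_integral => r _.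
rewrite patchE /abel_integrand/= st andbT.
case: ifPn => [rs|rs].
- by rewrite ifT// inE/= in_itv.
- by rewrite ifF//; apply/negbTE; rewrite notin_setE/= in_itv/=; apply/negP.
Qed.

(** The integral in s over [r, t] is a Beta integral. *)
Lemma abel_inner2 (R : realType) (p q t r : R) (psi : R -> R) :
  0 < p -> 0 < q -> (forall r, 0 <= psi r) -> 0 <= r < t ->
  (\int[mu]_s abel_integrand p q t psi (s, r) =
   ((t - r) `^ (p + q - 1) * Beta p q * psi r)%:E)%E.
Proof.
move=> p0 q0 psi0 /andP[r0 rt].
have ib := integrable_beta_itv p0 q0 rt.
have ib' : mu.-integrable `[r, t]
    (EFin \o (fun s => psi r * ((t - s) `^ (p - 1) * (s - r) `^ (q - 1)))).
  exact: LintegrableZ.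
rewrite -Rintegral_beta_itv// mulrC -RintegralZl// /Rintegral fineK; last first.
  exact: integrable_fin_num.
rewrite [RHS]integral_mkcond; apply: eq_integral => s _.
rewrite patchE /abel_integrand/= r0/=.
case: ifPn => [rs|rs].
- by rewrite ifT ?inE/= ?in_itv//=; congr (_%:E); ring.
- by rewrite ifF//; apply/negbTE; rewrite notin_setE/= in_itv/=; apply/negP.
Qed.

(** Exchanging the integrations over the triangle 0 <= r <= s <= t leaves a Beta
    integral inside.  The statement lives in the extended reals, where Tonelli's
    theorem applies; finiteness is settled afterwards, in
    [abel_inner_scaled]. *)
Lemma abel_tonelli (R : realType) (p q t : R) (psi : R -> R) :
  0 < p -> 0 < q -> 0 < t ->
  measurable_fun [set: R] psi -> (forall r, 0 <= psi r) ->
  (\int[mu]_(s in `[0%R, t]) (((t - s) `^ (p - 1))%:E *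
     \int[mu]_(r in `[0%R, s]) ((s - r) `^ (q - 1) * psi r)%:E) =
   \int[mu]_(r in `[0%R, t]) ((t - r) `^ (p + q - 1) * Beta p q * psi r)%:E)%E.
Proof.
move=> p0 q0 t0 mpsi psi0.
have mF := measurable_abel_integrand p q t mpsi.
have := @fubini_tonelli _ _ (measurableTypeR R) (measurableTypeR R) R
  (@lebesgue_measure R) (@lebesgue_measure R) _ mF
  (fun z => abel_integrand_ge0 p q t z psi0).
have mR : measurable_fun `[0, t[ (fun r => ((t - r) `^ (p + q - 1) * Beta p q * psi r)%:E).
  apply/measurable_EFinP; apply: measurable_funM; last exact: measurable_funTS.
  apply: measurable_funM => //.
  by apply: measurable_powR_comp; exact: measurable_funB.
(* At r = t the inner integral is over a point, so the Beta formula fails there. *)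
rewrite -(integral_itv_bndo_bndc mR) => E.
rewrite [LHS]integral_mkcond [RHS]integral_mkcond.
rewrite (eq_integral (fun s => \int[mu]_r abel_integrand p q t psi (s, r))%E); last first.
  move=> s _; rewrite patchE; case: ifPn.
    by rewrite inE/= in_itv/= => st; rewrite abel_inner1.
  rewrite notin_setE/= in_itv/= => /negP st; apply/esym/integral0_eq => r _.
  rewrite /abel_integrand/=; case: ifPn => // /and3P[r0 rs ts].
  by rewrite (le_trans r0 rs) ts in st.
rewrite [LHS]E; apply: eq_integral => r _; rewrite patchE; case: ifPn.
  by rewrite inE/= in_itv/= => rt; rewrite abel_inner2.
have out : (forall s, ~~ [&& 0 <= r, r <= s & s <= t]) ->
    (\int[mu]_s abel_integrand p q t psi (s, r) = 0)%E.
  by move=> h; apply: integral0_eq => s _; rewrite /abel_integrand/= (negbTE (h s)).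
rewrite notin_setE/= in_itv/= => /negP; rewrite negb_and -ltNge -leNgt => /orP[r0|tr].
  by apply: out => s; rewrite leNgt r0.
have [->|tr'] := eqVneq r t.
  suff -> : (\int[mu]_s abel_integrand p q t psi (s, t) = 0)%E by [].
  rewrite -(integral_set1 (fun s => abel_integrand p q t psi (s, t)) t).
  rewrite [RHS]integral_mkcond; apply: eq_integral => s _; rewrite patchE.
  case: ifPn => [//|]; rewrite notin_setE => st.
  rewrite /abel_integrand/= ifF//; apply/negbTE/negP => /and3P[_ ts ts'].
  by apply: st; apply/eqP; rewrite eq_le ts ts'.
apply: out => s; apply/negP => /and3P[_ rs st]; have := le_trans rs st.
by rewrite leNgt lt_neqAle tr eq_sym tr'.
Qed.

(** * From the fixed point to a solution of the Caputo equation *)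

(** The inner integral in the rescaled form used by the Picard operator. *)
Lemma abel_inner_scaled (R : realType) (al s : R) (g : R -> R) : 0 < al -> 0 <= s ->
  continuous g ->
  mu.-integrable `[0, s] (EFin \o (fun r => (s - r) `^ (al - 1) * (r `^ (al - 1) * g r))) /\
  \int[mu]_(r in `[0, s]) ((s - r) `^ (al - 1) * (r `^ (al - 1) * g r)) =
  s `^ (al - 1) * (`|s| `^ al * avg (beta_kernel al al) g s).
Proof.
move=> al0 s0 cg; have [C C0 HC] := continuous_bounded s0 cg.
have [->|sN0] := eqVneq s 0.
  rewrite normr0 (powR0 (lt0r_neq0 al0)) mul0r mulr0 set_itv1 Rintegral_set1; split => //.
  by apply: null_set_integrable; [exact: measurable_set1|exact: measurable_fun_set1|exact: lebesgue_measure_set1].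
have {sN0}s0 : 0 < s by rewrite lt_neqAle eq_sym sN0.
have ib := integrable_beta_itv al0 al0 s0.
have ii : mu.-integrable `[0, s]
    (EFin \o (fun r => (s - r) `^ (al - 1) * (r `^ (al - 1) * g r))).
  have ib' : mu.-integrable `[0, s]
      (EFin \o (fun r => (s - r) `^ (al - 1) * (r - 0) `^ (al - 1) * g r)).
    apply: (@LintegrableM_bounded _ _ _ _ C) => //.
      exact: measurable_fun_continuousT.
    by move=> r /=; rewrite in_itv/= => /andP[r0 rs]; apply: HC; rewrite ger0_norm.
  by apply: eq_integrable ib' => // r _ /=; rewrite subr0 mulrA.
split => //; rewrite Rintegral_rescale// subr0 gtr0_norm//.
transitivity (s * \int[mu]_(u in (`[0, 1] : set R))
    (s `^ (al + al - 2) * (beta_kernel al al u * g (s * u)))).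
  congr (_ * _); apply: eq_Rintegral => u /set_mem/=; rewrite in_itv/= => u01.
  have := beta_kernel_affine al al s0 u01; rewrite subr0 !add0r subr0 => E.
  by rewrite mulrA E mulrA.
rewrite RintegralZl//; last by apply: avg_integrable => //; exact: integrable_beta_kernel.
rewrite -/(avg _ _ _) !mulrA; congr (_ * _).
rewrite -[X in X * _ = _](powRr1 (ltW s0)) -!powRD ?(gt_eqF s0) ?implybT//.
by congr (_ `^ _); ring.
Qed.

Lemma abel_integrable (R : realType) (al t : R) (g : R -> R) : 0 < al < 1 -> 0 < t ->
  continuous g ->
  mu.-integrable `[0, t] (EFin \o (fun s => (t - s) `^ (1 - al - 1) * (s `^ (al - 1) * g s))).
Proof.
move=> /andP[al0 al1] t0 cg; have [C C0 HC] := continuous_bounded (ltW t0) cg.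
have p0 : 0 < 1 - al by rewrite subr_gt0.
have ib := integrable_beta_itv p0 al0 t0.
have ib' : mu.-integrable `[0, t]
      (EFin \o (fun r => (t - r) `^ (1 - al - 1) * (r - 0) `^ (al - 1) * g r)).
  apply: (@LintegrableM_bounded _ _ _ _ C) => //.
    exact: measurable_fun_continuousT.
  by move=> r /=; rewrite in_itv/= => /andP[r0 rs]; apply: HC; rewrite ger0_norm.
by apply: eq_integrable ib' => // r _ /=; rewrite subr0 mulrA.
Qed.

Lemma scaled_avg_continuous (R : realType) (al : R) (g : R -> R) : 0 < al ->
  continuous g -> continuous (fun s => `|s| `^ al * avg (beta_kernel al al) g s).
Proof.
move=> al0 cg s; apply: cvgM; first exact: continuous_norm_powR.
apply: avg_continuous => //; first exact: integrable_beta_kernel.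
by move=> u; exact: beta_kernel_ge0.
Qed.

Lemma abel_scaled_ge0 (R : realType) (al t : R) (g : R -> R) : 0 < al < 1 -> 0 < t ->
  continuous g -> (forall s, 0 <= g s) ->
  \int[mu]_(s in `[0, t]) ((t - s) `^ (1 - al - 1) *
     (s `^ (al - 1) * (`|s| `^ al * avg (beta_kernel al al) g s))) =
  Beta (1 - al) al * \int[mu]_(r in `[0, t]) (r `^ (al - 1) * g r).
Proof.
move=> /andP[al0 al1] t0 cg g0; have p0 : 0 < 1 - al by rewrite subr_gt0.
have mpsi : measurable_fun [set: R] (fun r => r `^ (al - 1) * g r).
  apply: measurable_funM; last exact: measurable_fun_continuousT.
  exact: measurable_powR_comp.
have psi0 r : 0 <= r `^ (al - 1) * g r by rewrite mulr_ge0 ?powR_ge0.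
have E := abel_tonelli p0 al0 t0 mpsi psi0.
rewrite -RintegralZl//; last exact: integrable_powR_itv.
rewrite /Rintegral; congr fine; transitivity (\int[mu]_(s in `[0%R, t])
   (((t - s) `^ (1 - al - 1))%:E *
     \int[mu]_(r in `[0%R, s]) ((s - r) `^ (al - 1) * (r `^ (al - 1) * g r))%:E))%E.
  apply: eq_integral => s; rewrite inE/= in_itv/= => /andP[s0 st].
  have [ii <-] := abel_inner_scaled al0 s0 cg.
  rewrite EFinM /Rintegral fineK//; exact: integrable_fin_num ii.
rewrite E; apply: eq_integral => r _.
by rewrite (_ : 1 - al + al - 1 = 0) ?powRr0 ?mul1r//; ring.
Qed.

(** Abel's identity for integrands of either sign, by splitting g into the
    difference of two nonnegative continuous functions. *)
Lemma abel_scaled (R : realType) (al t : R) (g : R -> R) : 0 < al < 1 -> 0 < t ->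
  continuous g ->
  \int[mu]_(s in `[0, t]) ((t - s) `^ (1 - al - 1) *
     (s `^ (al - 1) * (`|s| `^ al * avg (beta_kernel al al) g s))) =
  Beta (1 - al) al * \int[mu]_(r in `[0, t]) (r `^ (al - 1) * g r).
Proof.
move=> al01 t0 cg; have /andP[al0 al1] := al01.
pose g1 s := (`|g s| + g s) / 2; pose g2 s := (`|g s| - g s) / 2.
have cn : continuous (fun s => `|g s|).
  by move=> s; apply: continuous_comp; [exact: cg|exact: norm_continuous].
have cg1 : continuous g1.
  move=> s; apply: cvgM; last exact: cvg_cst.
  by apply: cvgD; [exact: cn|exact: cg].
have cg2 : continuous g2.
  move=> s; apply: cvgM; last exact: cvg_cst.
  by apply: cvgB; [exact: cn|exact: cg].
have g10 s : 0 <= g1 s.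
  by have := ler_norm (- g s); rewrite normrN /g1 => ?; rewrite divr_ge0//; lra.
have g20 s : 0 <= g2 s by rewrite divr_ge0// subr_ge0 ler_norm.
have gE s : g s = g1 s - g2 s by rewrite /g1 /g2; field.
have ib := integrable_beta_kernel al0 al0.
have gE' : g = (fun s => g1 s - g2 s) by apply/funext.
have E1 := abel_scaled_ge0 al01 t0 cg1 g10.
have E2 := abel_scaled_ge0 al01 t0 cg2 g20.
have i1 := abel_integrable al01 t0 (scaled_avg_continuous al0 cg1).
have i2 := abel_integrable al01 t0 (scaled_avg_continuous al0 cg2).
transitivity (\int[mu]_(s in `[0, t]) (
   (t - s) `^ (1 - al - 1) * (s `^ (al - 1) * (`|s| `^ al * avg (beta_kernel al al) g1 s)) -
   (t - s) `^ (1 - al - 1) * (s `^ (al - 1) * (`|s| `^ al * avg (beta_kernel al al) g2 s)))).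
  apply: eq_Rintegral => s _; rewrite gE' -(avgB _ ib)//; ring.
rewrite RintegralB// E1 E2 -mulrBr; congr (_ * _).
rewrite -RintegralB//; [|exact: integrable_powR_itv..].
by apply: eq_Rintegral => s _; rewrite gE mulrBr.
Qed.

(** The fractional integral of order 1 - al undoes that of order al: the first
    term of w contributes the Beta integral of [caputo_unit], the second one
    Abel's double integral, and the normalisation by [caputo_unit] makes both
    constants 1. *)
Lemma caputo_volterra (R : realType) (al f0 x0 t : R) (g w : R -> R) :
  0 < al <= 1 -> 0 < t -> continuous g -> continuous w ->
  (forall s, w s = (caputo_unit al)^-1 * f0 +
    (caputo_unit al)^-1 * (`|s| `^ al * avg (beta_kernel al al) g s)) ->
  caputo al (fun s => x0 + power_primitive al w s) t = f0 + power_primitive al g t.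
Proof.
move=> al01 t0 cg cw wE; have /andP[al0 al1] := al01.
have yE s : 0 < s -> (fun s => x0 + power_primitive al w s)^`()%classic s = s `^ (al - 1) * w s.
  move=> s0; rewrite derive1E.
  have h := power_primitive_derive al0 s0 cw.
  have h2 : is_derive s 1 (fun s => x0 + power_primitive al w s) (0 + s `^ (al - 1) * w s).
    exact: is_deriveD.
  by rewrite -[RHS]add0r; exact: derive_val.
have U0 := caputo_unit_gt0 al01.
have [alE|alN] := eqVneq al 1.
  rewrite {1}alE caputo1 yE// alE subrr powRr0 mul1r wE /caputo_unit alE eqxx invr1 !mul1r.
  rewrite /power_primitive /avg; congr (_ + _ * _); apply: eq_Rintegral => u _.
  by rewrite /beta_kernel subrr !powRr0 mulr1.
have {}al1 : al < 1 by rewrite lt_neqAle alN.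
have al01' : 0 < al < 1 by rewrite al0.
have p0 : 0 < 1 - al by rewrite subr_gt0.
have B0 : 0 < Beta (1 - al) al by apply: Beta_gt0; apply/andP; split; lra.
have G0 : 0 < Gamma (1 - al) by apply: Gamma_gt0; apply/andP; split; lra.
have UE : caputo_unit al = (Gamma (1 - al))^-1 * Beta (1 - al) al.
  by rewrite /caputo_unit (negbTE alN).
rewrite caputo_lt1//.
set kap := (caputo_unit al)^-1 in wE.
have iw := abel_integrable al01' t0 cw.
have iw1 : mu.-integrable `]0, t] (EFin \o (fun s => (t - s) `^ (1 - al - 1) * (s `^ (al - 1) * w s))).
  by apply: integrableS iw => //; apply: subset_itvr; rewrite bnd_simp.
pose Dy := (fun s => x0 + power_primitive al w s)^`()%classic.
(* The derivative of the solution is known on ]0, t] only. *)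
have iD1 : mu.-integrable `]0, t] (EFin \o (fun s => (t - s) `^ (1 - al - 1) * Dy s)).
  apply: eq_integrable iw1 => // s /set_mem/=; rewrite in_itv/= => /andP[s0 _].
  by rewrite /Dy yE.
rewrite -/Dy -(Rintegral_itv_obnd_cbnd iD1).
have -> : \int[mu]_(s in `]0, t]) ((t - s) `^ (1 - al - 1) * Dy s) =
    \int[mu]_(s in `]0, t]) ((t - s) `^ (1 - al - 1) * (s `^ (al - 1) * w s)).
  by apply: eq_Rintegral => s /set_mem/=; rewrite in_itv/= => /andP[s0 _]; rewrite /Dy yE.
rewrite (Rintegral_itv_obnd_cbnd iw1).
have ib := integrable_beta_itv p0 al0 t0.
have ig := abel_integrable al01' t0 (scaled_avg_continuous al0 cg).
have ib' := LintegrableZ (kap * f0) (measurable_itv _) ib.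
have ig' := LintegrableZ kap (measurable_itv _) ig.
have -> : \int[mu]_(s in `[0, t]) ((t - s) `^ (1 - al - 1) * (s `^ (al - 1) * w s)) =
  \int[mu]_(s in `[0, t]) (kap * f0 * ((t - s) `^ (1 - al - 1) * (s - 0) `^ (al - 1)) +
     kap * ((t - s) `^ (1 - al - 1) *
       (s `^ (al - 1) * (`|s| `^ al * avg (beta_kernel al al) g s)))).
  by apply: eq_Rintegral => s _; rewrite wE subr0; ring.
rewrite RintegralD// !RintegralZl// Rintegral_beta_itv// abel_scaled//.
rewrite power_primitiveE//.
rewrite (_ : 1 - al + al - 1 = 0) ?powRr0 ?mul1r; last by ring.
rewrite /kap UE; field.
by rewrite !gt_eqF.
Qed.

(** Both sides are continuous on [0, t], vanish at 0 and have the same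
    derivative on ]0, t[, by the chain rule for f(y). *)
Lemma power_primitive_chain (R : realType) (al x0 t : R) (f f' h w : R -> R) :
  0 < al -> 0 < t -> continuous w -> continuous h ->
  (forall u : R, is_derive u 1 f (f' u)) ->
  (forall s, 0 <= s <= t -> h (x0 + power_primitive al w s) = f' (x0 + power_primitive al w s)) ->
  power_primitive al (fun s => h (x0 + power_primitive al w s) * w s) t =
    f (x0 + power_primitive al w t) - f x0.
Proof.
move=> al0 t0 cw ch df hf.
pose y s := x0 + power_primitive al w s.
pose g s := h (y s) * w s.
have cg : continuous g by exact: picard_integrand_continuous.
have cy : continuous y.
  by move=> s; apply: cvgD; [exact: cvg_cst|exact: power_primitive_continuous].
have cf : continuous f by move=> u; exact: is_derive_continuous (df u).
pose phi s := power_primitive al g s - f (y s).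
have dphi s : s \in `]0, t[ -> is_derive s 1 phi ((fun _ => 0) s).
  rewrite in_itv/= => /andP[s0 st].
  have h1 := power_primitive_derive al0 s0 cg.
  have h2 : is_derive s 1 y (0 + s `^ (al - 1) * w s).
    by have := power_primitive_derive al0 s0 cw; exact: is_deriveD.
  have h3 := is_derive1_comp (df (y s)) h2.
  have h4 := is_deriveB h1 h3.
  apply: (is_derive_eq h4).
  rewrite /g hf ?(ltW s0) ?(ltW st)// -/(y s); ring.
have cphi : {within `[0, t], continuous phi}.
  apply: continuous_within_of => s _; apply: cvgB; first exact: power_primitive_continuous.
  apply: (@continuous_comp _ _ _ y f); [exact: cy|exact: cf].
have [c _] := MVT t0 dphi cphi.
rewrite mul0r /phi /y power_primitive0// power_primitive0// addr0 => /eqP.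
rewrite subr_eq0 => /eqP; rewrite -/(y t) => E.
by rewrite -/(y t) -/g; lra.
Qed.

(** Global existence for the equation in which f' is replaced by h.  The
    solution satisfies the original equation at t whenever it has stayed, up to
    t, where h and f' agree. *)
Lemma clamped_solution (R : realType) (al del x0 H L : R) (f f' h : R -> R) :
  0 < al <= 1 -> 0 <= H -> 0 <= L ->
  (forall u, `|h u| <= H) -> (forall u v, `|h u - h v| <= L * `|u - v|) ->
  (forall u : R, is_derive u 1 f (f' u)) ->
  (forall u, `|u| <= del -> h u = f' u) ->
  exists y : R -> R, [/\ y 0 = x0, continuous y, (forall T, 0 < T -> frac_regular y T) &
    forall t, 0 < t -> (forall s, 0 <= s <= t -> `|y s| <= del) -> caputo al y t = f (y t)].
Proof.
move=> al01 H0 L0 hH hL df hf; have /andP[al0 al1] := al01.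
have U0 := caputo_unit_gt0 al01.
pose kap := (caputo_unit al)^-1.
have kap0 : 0 < kap by rewrite invr_gt0.
have [w cw wE] := picard_solution (kap * f x0) x0 al01 kap0 H0 L0 hH hL.
have ch := lipschitz_continuous hL.
exists (fun s => x0 + power_primitive al w s); split.
- by rewrite power_primitive0// addr0.
- by move=> s; apply: cvgD; [exact: cvg_cst|exact: power_primitive_continuous].
- move=> T T0; have [C C0 HC] := continuous_bounded (ltW T0) cw.
  have h1 (s : R) : 0 < s -> is_derive s 1 (fun s => x0 + power_primitive al w s) (s `^ (al - 1) * w s).
    move=> s0; have := power_primitive_derive al0 s0 cw => hw.
    by rewrite -[X in is_derive _ _ _ X]add0r; exact: is_deriveD.
  have h2 (s : R) : 0 < s -> {for s, continuous (fun s => s `^ (al - 1) * w s)}.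
    by move=> s0; apply: cvgM; [exact: continuous_powR_gt0|exact: cw].
  have h3 (s : R) : 0 < s < T -> `|s `^ (al - 1) * w s| <= C * s `^ (al - 1).
    move=> /andP[s0 sT]; rewrite normrM (ger0_norm (powR_ge0 _ _)) mulrC.
    by rewrite ler_wpM2r ?powR_ge0// HC// gtr0_norm// ltW.
  by have [] := frac_regular_of al0 h1 h2 T0 h3.
- move=> t t0 ydel.
  have cg := @picard_integrand_continuous _ al x0 h w al0 ch cw.
  rewrite (caputo_volterra (f0 := f x0) x0 al01 t0 cg cw); last first.
    by move=> s; rewrite -[LHS]wE.
  rewrite (power_primitive_chain al0 t0 cw ch df); first by ring.
  by move=> s st; apply: hf; exact: ydel.
Qed.

(** * Cubic right-hand sides and explicit barriers *)

(** Composed with f', it gives a bounded Lipschitz function that agrees with f'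
    on [- d, d]. *)
Definition clamp {R : realType} (d u : R) : R := Num.max (- d) (Num.min d u).

Lemma clamp_norm (R : realType) (d u : R) : 0 <= d -> `|clamp d u| <= d.
Proof.
move=> d0; rewrite ler_norml /clamp le_max lexx /= ge_max ge_min lexx/= andbT; lra.
Qed.

Lemma clamp_id (R : realType) (d u : R) : `|u| <= d -> clamp d u = u.
Proof.
by rewrite ler_norml /clamp => /andP[u1 u2]; rewrite min_r// max_r.
Qed.

Lemma clamp_lipschitz (R : realType) (d u v : R) : 0 <= d ->
  `|clamp d u - clamp d v| <= `|u - v|.
Proof.
move=> d0.
wlog uv : u v / u <= v.
  by move=> H; have [/H//|/ltW/H] := leP u v; rewrite distrC (distrC v).
rewrite !(distrC u) (distrC (clamp d u)) !ger0_norm ?subr_ge0//; last first.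
  rewrite /clamp ge_max le_max lexx/= le_max; apply/orP; right.
  by rewrite le_min ge_min lexx/= ge_min uv orbT.
rewrite /clamp /Num.max /Num.min; do 4 case: ifPn; rewrite -?leNgt; lra.
Qed.

Definition cubic_deriv {R : realType} (a b c u : R) : R :=
  3 * a * u ^+ 2 + 2 * b * u + c.

Lemma is_derive_cubic (R : realType) (a b c u : R) :
  is_derive u 1 (cubic a b c) (cubic_deriv a b c u).
Proof.
have h1 : is_derive u 1 (fun x : R => x ^+ 3) (3 * u ^+ 2 * 1).
  by have := is_deriveX 3 (is_derive_id u (1 : R)); exact.
have h2 : is_derive u 1 (fun x : R => x ^+ 2) (2 * u * 1).
  by have := is_deriveX 2 (is_derive_id u (1 : R)); rewrite /= expr1; exact.
have h3 := is_deriveD (is_deriveD (is_deriveZ a h1) (is_deriveZ b h2))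
  (is_deriveZ c (is_derive_id u (1 : R))).
apply: (is_derive_eq h3).
by rewrite /cubic_deriv /GRing.scale/=; ring.
Qed.

Lemma cubic_solution (R : realType) (al a b c del x0 : R) :
  0 < al <= 1 -> 0 <= del ->
  exists y : R -> R, [/\ y 0 = x0, continuous y, (forall T, 0 < T -> frac_regular y T) &
    forall t, 0 < t -> (forall s, 0 <= s <= t -> `|y s| <= del) ->
      caputo al y t = cubic a b c (y t)].
Proof.
move=> al01 d0.
pose h u := cubic_deriv a b c (clamp del u).
pose H := 3 * `|a| * del ^+ 2 + 2 * `|b| * del + `|c|.
pose L := 6 * `|a| * del + 2 * `|b|.
have del2 : 0 <= del ^+ 2 by rewrite exprn_ge0.
have H0 : 0 <= H by rewrite !addr_ge0 ?mulr_ge0.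
have L0 : 0 <= L by rewrite addr_ge0 ?mulr_ge0.
have hH u : `|h u| <= H.
  have cn := clamp_norm u d0; rewrite /h /cubic_deriv.
  apply: le_trans (ler_normD _ _) _; rewrite lerD2r.
  apply: le_trans (ler_normD _ _) _; apply: lerD.
    rewrite (normrM (3 * a)) (normrM 3) (ger0_norm (ler0n _ 3)) ler_wpM2l ?mulr_ge0//.
    by rewrite normrX ler_pXn2r ?nnegrE.
  by rewrite (normrM (2 * b)) (normrM 2) (ger0_norm (ler0n _ 2)) ler_wpM2l ?mulr_ge0.
have hL u v : `|h u - h v| <= L * `|u - v|.
  have cu := clamp_norm u d0; have cv := clamp_norm v d0.
  have cuv := clamp_lipschitz u v d0; rewrite /h /cubic_deriv.
  set p := clamp del u in cu cuv *; set q := clamp del v in cv cuv *.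
  have -> : 3 * a * p ^+ 2 + 2 * b * p + c - (3 * a * q ^+ 2 + 2 * b * q + c) =
    (3 * a * (p + q) + 2 * b) * (p - q) by ring.
  rewrite normrM; apply: ler_pM => //.
  apply: le_trans (ler_normD _ _) _.
  rewrite (normrM (3 * a)) (normrM 3) (normrM 2) (ger0_norm (ler0n _ 2)) (ger0_norm (ler0n _ 3)).
  rewrite /L lerD2r.
  have -> : 6 * `|a| * del = 3 * `|a| * (del + del) by ring.
  rewrite ler_wpM2l ?mulr_ge0// (le_trans (ler_normD _ _))// lerD//.
apply: (clamped_solution x0 al01 H0 L0 hH hL (is_derive_cubic a b c)) => u ud.
by rewrite /h clamp_id.
Qed.

Lemma cubic0 (R : realType) (a b c : R) : cubic a b c 0 = 0.
Proof. by rewrite /cubic !expr0n/= !mulr0 !addr0. Qed.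

(** For del = - c / (3 |a| + 2 |b| - c), which is at most 1, the linear term
    dominates in the difference quotient. *)
Lemma cubic_decreasing (R : realType) (a b c : R) : c < 0 ->
  exists2 del, 0 < del & forall u v, `|u| <= del -> `|v| <= del -> u < v ->
    cubic a b c v < cubic a b c u.
Proof.
move=> c0; pose S := 3 * `|a| + 2 * `|b|.
have S0 : 0 <= S by rewrite addr_ge0 ?mulr_ge0.
have Sc : 0 < S - c by lra.
exists (- c / (S - c)); first by rewrite divr_gt0// oppr_gt0.
set del := - c / (S - c) => u v ud vd uv.
have d0 : 0 < del by rewrite divr_gt0// oppr_gt0.
have d1 : del <= 1 by rewrite ler_pdivrMr// mul1r; lra.
have dS : S * del < - c by rewrite mulrA ltr_pdivrMr//; nra.
rewrite -subr_gt0.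
have -> : cubic a b c u - cubic a b c v =
  (v - u) * - (a * (v ^+ 2 + u * v + u ^+ 2) + b * (u + v) + c) by rewrite /cubic; ring.
rewrite mulr_gt0 ?subr_gt0// oppr_gt0.
have dd : del * del <= del by rewrite ler_piMl// ltW.
have h1 : a * (v ^+ 2 + u * v + u ^+ 2) <= `|a| * (3 * del).
  apply: le_trans (ler_norm _) _; rewrite normrM ler_wpM2l//.
  have uu : `|u * u| <= del * del by rewrite normrM; apply: ler_pM.
  have vv : `|v * v| <= del * del by rewrite normrM; apply: ler_pM.
  have uv' : `|u * v| <= del * del by rewrite normrM; apply: ler_pM.
  rewrite !expr2; apply: le_trans (ler_normD _ _) _.
  have := ler_normD (v * v) (u * v); lra.
have h2 : b * (u + v) <= `|b| * (2 * del).
  apply: le_trans (ler_norm _) _; rewrite normrM ler_wpM2l//.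
  have := ler_normD u v; lra.
rewrite /S in dS; lra.
Qed.

Lemma cubic_growth (R : realType) (a b c : R) : 0 < c ->
  exists2 del, 0 < del & forall u, 0 <= u <= del -> c / 2 * u <= cubic a b c u.
Proof.
move=> c0; pose S := `|a| + `|b|.
have S0 : 0 <= S by rewrite addr_ge0.
have Sc : 0 < S + c / 2 by lra.
exists (c / 2 / (S + c / 2)); first by rewrite divr_gt0// divr_gt0.
set del := c / 2 / _ => u /andP[u0 ud].
have d1 : del <= 1 by rewrite ler_pdivrMr// mul1r; lra.
have dS : S * del <= c / 2.
  by rewrite mulrA ler_pdivrMr//; nra.
have -> : cubic a b c u = (a * (u * u) + b * u + c) * u by rewrite /cubic; ring.
rewrite ler_wpM2r//.
have uu : u * u <= del by rewrite (le_trans _ ud)// ler_piMl//; lra.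
have h1 : - (`|a| * del) <= a * (u * u).
  rewrite lerNl; apply: le_trans (ler_norm _) _.
  by rewrite normrN normrM ler_wpM2l// ger0_norm// mulr_ge0.
have h2 : - (`|b| * del) <= b * u.
  rewrite lerNl; apply: le_trans (ler_norm _) _.
  by rewrite normrN normrM ler_wpM2l// ger0_norm.
rewrite /S in dS; lra.
Qed.

(** A multiple of `|t| `^ al ([barrier_powerE]), normalised so that its
    derivative is t `^ (al - 1). *)
Definition barrier_power {R : realType} (al t : R) : R :=
  power_primitive al (cst 1) t.

Lemma barrier_power_continuous (R : realType) (al : R) : 0 < al ->
  continuous (@barrier_power R al).
Proof.
by move=> al0; apply: power_primitive_continuous => // x; exact: cst_continuous.
Qed.

Lemma barrier_power_derive (R : realType) (al t : R) : 0 < al -> 0 < t ->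
  is_derive t 1 (barrier_power al) (t `^ (al - 1)).
Proof.
move=> al0 t0; rewrite -[X in is_derive _ _ _ X]mulr1.
by apply: (@power_primitive_derive _ al t (cst 1)) => // x; exact: cst_continuous.
Qed.

Lemma barrier_powerE (R : realType) (al t : R) :
  barrier_power al t = `|t| `^ al * Beta 1 al.
Proof.
rewrite /barrier_power /power_primitive /avg /Beta; congr (_ * _).
by apply: eq_Rintegral => u _; rewrite /beta_kernel subrr powRr0 mul1r mulr1.
Qed.

Lemma barrier_power_ge0 (R : realType) (al t : R) : 0 < al <= 1 ->
  0 <= barrier_power al t.
Proof.
move=> al01; rewrite barrier_powerE mulr_ge0 ?powR_ge0// ltW// Beta_gt0//.
by rewrite ltr01 lexx.
Qed.

Lemma barrier_power_large (R : realType) (al A : R) : 0 < al <= 1 ->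
  exists2 t0, 0 < t0 & forall t, t0 <= t -> A <= barrier_power al t.
Proof.
move=> al01; have /andP[al0 al1] := al01.
have B0 : 0 < Beta 1 al by rewrite Beta_gt0// ltr01 lexx.
pose t0 := ((`|A| + 1) / Beta 1 al) `^ al^-1.
have t00 : 0 < t0 by rewrite powR_gt0// divr_gt0// ltr_wpDl.
exists t0 => // t tt; rewrite barrier_powerE ger0_norm; last exact: le_trans (ltW t00) tt.
have := le_powR_nonneg (ltW al0) (ltW t00) tt.
rewrite /t0 -powRrM mulVf ?gt_eqF// powRr1; last by rewrite divr_ge0 ?addr_ge0// ltW.
rewrite ler_pdivrMr//; apply: le_trans.
by rewrite (le_trans (ler_norm _))// lerDl.
Qed.

(** The derivative of the barrier is at most |B| rho t `^ (al - 1) in absolute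
    value, because the denominator is at least 1; so its Caputo derivative is
    uniformly small for small rho, although the barrier tends to A. *)
Lemma decaying_barrier (R : realType) (al rho A B : R) (w : R -> R) :
  0 < al <= 1 -> 0 < rho -> w = (fun t => A + B / (1 + rho * barrier_power al t)) ->
  [/\ continuous w, (forall T, 0 < T -> frac_regular w T) &
    forall t, 0 < t -> `|caputo al w t| <= `|B| * rho * caputo_unit al].
Proof.
move=> al01 rho0 wE; have /andP[al0 al1] := al01.
pose den t := 1 + rho * barrier_power al t.
have den1 t : 1 <= den t.
  by rewrite lerDl mulr_ge0 ?barrier_power_ge0// ltW.
have den0 t : 0 < den t by exact: lt_le_trans (den1 t).
have cden : continuous den.
  move=> t; apply: cvgD; first exact: cvg_cst.
  by apply: cvgM; [exact: cvg_cst|exact: barrier_power_continuous].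
have cw : continuous w.
  rewrite wE => t; apply: cvgD; first exact: cvg_cst.
  apply: cvgM; first exact: cvg_cst.
  apply: cvgV; first by have := lt0r_neq0 (den0 t).
  exact: cden.
pose v t := - (B * rho) * t `^ (al - 1) / (den t ^+ 2).
have h1 (t : R) : 0 < t -> is_derive t 1 w (v t).
  move=> t0; have hp := barrier_power_derive al0 t0.
  have hd : is_derive t 1 den (0 + rho * t `^ (al - 1)).
    by have hz := is_deriveZ rho hp; exact: is_deriveD.
  have hi := is_deriveV (lt0r_neq0 (den0 t)) hd.
  have hz := is_deriveZ B hi.
  have hw : is_derive t 1 w (0 + B *: (- den t ^- 2 *: (0 + rho * t `^ (al - 1)))).
    by rewrite wE; exact: is_deriveD.
  apply: (is_derive_eq hw); rewrite /v /GRing.scale/=; ring.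
have h2 (t : R) : 0 < t -> {for t, continuous v}.
  move=> t0; apply: cvgM.
    by apply: cvgM; [exact: cvg_cst|exact: continuous_powR_gt0].
  apply: cvgV; first by rewrite expf_eq0 (gt_eqF (den0 t)) andbF.
  by rewrite expr2; apply: cvgM; exact: cden.
have vB (t : R) : 0 < t -> `|v t| <= `|B| * rho * t `^ (al - 1).
  move=> t0; rewrite /v !normrM normrN normrM (gtr0_norm rho0) (ger0_norm (powR_ge0 _ _)).
  rewrite ler_piMr ?mulr_ge0 ?powR_ge0 ?(ltW rho0)//.
  by rewrite ger0_norm ?invr_ge0 ?exprn_ge0 ?(ltW (den0 t))// invf_le1 ?exprn_gt0// exprn_ege1.
have reg T : 0 < T -> frac_regular w T /\ (forall s : R, 0 < s -> w^`()%classic s = v s).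
  by move=> T0; apply: (frac_regular_of al0 h1 h2 T0) => s /andP[s0 _]; exact: vB.
split => //; first by move=> T /reg[].
move=> t t0; have [rw dw] := reg t t0; rewrite ler_norml; apply/andP; split.
- rewrite -mulNr; apply: caputo_ge_power => // s /andP[s0 _]; rewrite dw// mulNr.
  by have := vB s s0; rewrite ler_norml => /andP[].
- apply: caputo_le_power => // s /andP[s0 _]; rewrite dw//.
  by have := vB s s0; rewrite ler_norml => /andP[].
Qed.

Lemma growing_barrier (R : realType) (al rho A : R) (w : R -> R) :
  0 < al <= 1 -> w = (fun t => A + rho * barrier_power al t) ->
  [/\ continuous w, (forall T, 0 < T -> frac_regular w T) &
    forall t, 0 < t -> caputo al w t <= rho * caputo_unit al].
Proof.
move=> al01 wE; have /andP[al0 al1] := al01.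
have cw : continuous w.
  rewrite wE => t; apply: cvgD; first exact: cvg_cst.
  by apply: cvgM; [exact: cvg_cst|exact: barrier_power_continuous].
pose v t := rho * t `^ (al - 1).
have h1 (t : R) : 0 < t -> is_derive t 1 w (v t).
  move=> t0; have hz := is_deriveZ rho (barrier_power_derive al0 t0).
  by rewrite wE -[v t]add0r; exact: is_deriveD.
have h2 (t : R) : 0 < t -> {for t, continuous v}.
  by move=> t0; apply: cvgM; [exact: cvg_cst|exact: continuous_powR_gt0].
have vB (t : R) : `|v t| <= `|rho| * t `^ (al - 1).
  by rewrite normrM (ger0_norm (powR_ge0 _ _)).
have reg T : 0 < T -> frac_regular w T /\ (forall s : R, 0 < s -> w^`()%classic s = v s).
  by move=> T0; apply: (frac_regular_of al0 h1 h2 T0) => s _; exact: vB.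
split => //; first by move=> T /reg[].
move=> t t0; have [rw dw] := reg t t0.
by apply: caputo_le_power => // s /andP[s0 _]; rewrite dw.
Qed.

(** * Stability and instability of the origin *)

Lemma continuous_within_itv (R : realType) (f : R -> R) (a b : R) :
  continuous f -> {within `[a, b], continuous f}.
Proof. by move=> cf; apply: continuous_within_of => x _; exact: cf. Qed.

Lemma caputo_solution_upto (R : realType) (al : R) (f x : R -> R) (T : \bar R) (t : R) :
  caputo_solution al f T x -> 0 < t -> (t%:E < T)%E ->
  [/\ {within `[0, t], continuous x}, frac_regular x t &
    forall s, 0 < s <= t -> caputo al x s = f (x s)].
Proof.
move=> [T0 cx dx ix ex] t0 tT.
have sT s : s <= t -> (s%:E < T)%E by move=> st; apply: le_lt_trans tT; rewrite lee_fin.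
split.
- by apply: continuous_subspaceW cx => s /=; rewrite in_itv/= => /andP[s0 /sT].
- by split; [move=> s /andP[s0 /sT]; exact: dx|exact: ix].
- by move=> s /andP[s0 /sT]; exact: ex.
Qed.

Lemma caputo_solution_of (R : realType) (al : R) (f y : R -> R) (T : \bar R) :
  (0 < T)%E -> continuous y -> (forall t, 0 < t -> frac_regular y t) ->
  (forall t, 0 < t -> (t%:E < T)%E -> caputo al y t = f (y t)) ->
  caputo_solution al f T y.
Proof.
move=> T0 cy ry ey; split => //.
- by apply: continuous_within_of => x _; exact: cy.
- by move=> t t0 _; apply: (ry t t0).1; rewrite t0 lexx.
- by move=> t t0 _; exact: (ry t t0).2.
Qed.

(** The global solution comes from the truncated equation, whose truncation is
    inactive since y stays within its initial distance of 0; it extends x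
    because two solutions with the same initial value compare in both
    directions. *)
Lemma cubic_stable_core (R : realType) (al a b c del : R) (T : \bar R) (x : R -> R) :
  0 < al <= 1 -> 0 < del ->
  (forall u v, `|u| <= del -> `|v| <= del -> u < v -> cubic a b c v < cubic a b c u) ->
  caputo_solution al (cubic a b c) T x -> `|x 0| < del ->
  exists y : R -> R, [/\ continuous y, (forall t, 0 < t -> frac_regular y t),
    (forall t, 0 < t -> caputo al y t = cubic a b c (y t)),
    (forall t, 0 <= t -> `|y t| <= `|x 0|) &
    global_extension al (cubic a b c) T x y /\ y 0 = x 0].
Proof.
move=> al01 d0 fdec solx x0d; set f := cubic a b c in fdec solx *.
have f0 : f 0 = 0 by exact: cubic0.
have [y [y0 cy ry ey]] := cubic_solution a b c (x 0) al01 (ltW d0).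
have yB t : 0 <= t -> `|y t| <= `|x 0|.
  move=> t0; apply: (@bounded_by_initial _ al del `|x 0| t f y) => //.
  - exact: continuous_within_itv.
  - exact: ry.
  - by move=> s /andP[s0 _]; exact: ey.
  - by rewrite y0.
  - by rewrite t0 lexx.
have ey' t : 0 < t -> caputo al y t = f (y t).
  move=> t0; apply: ey => // s /andP[s0 _].
  by rewrite (le_trans (yB s s0))// ltW.
exists y; split => //; split => //; split.
  by apply: caputo_solution_of => // t t0 _; exact: ey'.
move=> t; rewrite le_eqVlt => /predU1P[<- //|t0] tT.
have [cx rx ex] := caputo_solution_upto solx t0 tT.
have xB s : 0 <= s <= t -> `|x s| <= `|x 0|.
  by apply: (@bounded_by_initial _ al del `|x 0| t f x) => // s' st _; exact: ex.
have xyB s : 0 <= s <= t -> `|x s| <= del /\ `|y s| <= del.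
  move=> st; split; first by rewrite (le_trans (xB s st))// ltW.
  by move: st => /andP[s0 _]; rewrite (le_trans (yB s s0))// ltW.
apply/eqP; rewrite eq_le; apply/andP; split.
- apply: (@comparison _ al del t f y x) => //.
  + exact: continuous_within_itv.
  + exact: ry.
  + by move=> s /xyB[].
  + by move=> s /andP[s0 _]; rewrite ey'.
  + by move=> s st; rewrite ex.
  + by rewrite y0.
- apply: (@comparison _ al del t f x y) => //.
  + exact: continuous_within_itv.
  + exact: ry.
  + by move=> s st; rewrite ex.
  + by move=> s /andP[s0 _]; rewrite ey'.
  + by rewrite y0.
Qed.

(** For every small eta, the barriers eta + m / (1 + rho p) and its opposite are
    a super- and a subsolution once rho is small, since f is at most f(eta) < 0
    along the first and at least f(- eta) > 0 along the second.  They confine y,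
    and both end up within 2 eta of 0. *)
Lemma cubic_decay (R : realType) (al a b c del : R) (y : R -> R) :
  0 < al <= 1 -> 0 < del ->
  (forall u v, `|u| <= del -> `|v| <= del -> u < v -> cubic a b c v < cubic a b c u) ->
  continuous y -> (forall t, 0 < t -> frac_regular y t) ->
  (forall t, 0 < t -> caputo al y t = cubic a b c (y t)) ->
  `|y 0| < del -> (forall t, 0 <= t -> `|y t| <= `|y 0|) ->
  y t @[t --> +oo] --> 0.
Proof.
move=> al01 d0 fdec cy ry ey y0d yB; set f := cubic a b c in fdec ey *.
have f0 : f 0 = 0 by exact: cubic0.
have U0 := caputo_unit_gt0 al01.
pose m := `|y 0|; have m0 : 0 <= m by exact: normr_ge0.
apply/cvgrPdist_le => e e0.
pose eta := Num.min (e / 2) (del - m).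
have eta0 : 0 < eta by rewrite lt_min divr_gt0//= subr_gt0.
have [etae etad] : eta <= e / 2 /\ eta <= del - m by split; rewrite /eta ge_min lexx ?orbT.
have en : `|eta| <= del by rewrite gtr0_norm//; lra.
have feta : f eta < 0 by rewrite -f0; apply: fdec => //; rewrite normr0 ltW.
have fNeta : 0 < f (- eta).
  by rewrite -f0; apply: fdec; rewrite ?normrN ?normr0 ?oppr_lt0// ltW.
pose kap := Num.min (- f eta) (f (- eta)).
have kap0 : 0 < kap by rewrite lt_min oppr_gt0 feta.
have [kap1 kap2] : kap <= - f eta /\ kap <= f (- eta) by split; rewrite /kap ge_min lexx ?orbT.
have mU : 0 <= m * caputo_unit al by rewrite mulr_ge0// ltW.
(* The Caputo derivatives of the barriers are then at most kap; adding 1 covers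
   m = 0. *)
pose rho := kap / (m * caputo_unit al + 1).
have rho0 : 0 < rho by rewrite divr_gt0// ltr_wpDl.
have rhok : m * rho * caputo_unit al <= kap.
  rewrite (_ : _ * _ * _ = kap * (m * caputo_unit al) / (m * caputo_unit al + 1)); last by rewrite /rho; ring.
  by rewrite ler_pdivrMr ?ltr_wpDl// ler_wpM2l ?(ltW kap0)// lerDl.
pose q t := m / (1 + rho * barrier_power al t).
have den1 t : 1 <= 1 + rho * barrier_power al t.
  by rewrite lerDl mulr_ge0 ?barrier_power_ge0// ltW.
have q0 t : 0 <= q t by rewrite divr_ge0// (le_trans _ (den1 t)).
have qm t : q t <= m.
  by rewrite ler_pdivrMr ?(lt_le_trans _ (den1 t))// ler_peMr.
have bp0 : barrier_power al 0 = 0 :> R.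
  by rewrite /barrier_power power_primitive0//; case/andP : al01.
have q00 : q 0 = m by rewrite /q bp0 mulr0 addr0 divr1.
pose w1 t := eta + m / (1 + rho * barrier_power al t).
pose w2 t := - eta + (- m) / (1 + rho * barrier_power al t).
have w1E t : w1 t = eta + q t by [].
have w2E t : w2 t = - (eta + q t) by rewrite /w2 /q mulNr opprD.
have [cw1 rw1 ew1] := @decaying_barrier _ al rho eta m w1 al01 rho0 erefl.
have [cw2 rw2 ew2] := @decaying_barrier _ al rho (- eta) (- m) w2 al01 rho0 erefl.
have wb t : `|eta + q t| <= del.
  by rewrite ger0_norm ?addr_ge0 ?(ltW eta0)//; have := qm t; lra.
have yd t : 0 <= t -> `|y t| <= del by move=> t0; rewrite (le_trans (yB t t0))// ltW.
have f1 t : 0 < t -> f (w1 t) <= caputo al w1 t.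
  move=> t0; have h : f (w1 t) <= f eta.
    rewrite w1E; have := q0 t; rewrite le_eqVlt => /predU1P[<-|qt]; first by rewrite addr0.
    by rewrite ltW// fdec// ltrDl.
  have := ew1 t t0; rewrite (ger0_norm m0) ler_norml => /andP[+ _].
  lra.
have f2 t : 0 < t -> caputo al w2 t <= f (w2 t).
  move=> t0; have h : f (- eta) <= f (w2 t).
    rewrite w2E; have := q0 t; rewrite le_eqVlt => /predU1P[<-|qt]; first by rewrite addr0.
    by rewrite ltW// fdec ?normrN// ltrN2 ltrDl.
  have := ew2 t t0; rewrite normrN (ger0_norm m0) ler_norml => /andP[_ +].
  lra.
have [t0 t00 Ht0] := barrier_power_large (m / (eta * rho)) al01.
exists t0; split; first exact: num_real.
move=> t t0t; rewrite sub0r normrN.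
have tpos : 0 < t by exact: lt_trans t0t.
have q_small : q t <= eta.
  rewrite ler_pdivrMr ?(lt_le_trans _ (den1 t))//.
  have er : 0 < eta * rho by exact: mulr_gt0.
  have := Ht0 t (ltW t0t); rewrite (ler_pdivrMr _ _ er) => h.
  rewrite (_ : eta * _ = eta + barrier_power al t * (eta * rho)); last by ring.
  by apply: le_trans h _; rewrite lerDr ltW.
have y0m := ler_norm (y 0); have y0m' := ler_norm (- y 0); rewrite normrN -/m in y0m'; rewrite -/m in y0m.
have le1 : y t <= w1 t.
  apply: (comparison al01 tpos fdec (continuous_within_itv cy)
    (continuous_within_itv cw1) (ry t tpos) (rw1 t tpos)).
  - by move=> s /andP[s0 _]; split; [exact: yd|rewrite w1E].
  - by move=> s /andP[s0 _]; rewrite ey.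
  - by move=> s /andP[s0 _]; exact: f1.
  - by rewrite w1E q00 -/m; lra.
have le2 : w2 t <= y t.
  apply: (comparison al01 tpos fdec (continuous_within_itv cw2)
    (continuous_within_itv cy) (rw2 t tpos) (ry t tpos)).
  - by move=> s /andP[s0 _]; split; [rewrite w2E normrN|exact: yd].
  - by move=> s /andP[s0 _]; exact: f2.
  - by move=> s /andP[s0 _]; rewrite ey.
  - by rewrite w2E q00 -/m; lra.
have qe : eta + q t <= e by lra.
rewrite w1E in le1; rewrite w2E in le2; rewrite ler_norml.
by rewrite (le_trans le1 qe) (le_trans _ le2)// lerN2.
Qed.

Lemma cubic_asymptotically_stable (R : realType) (al a b c : R) :
  0 < al <= 1 -> c < 0 -> locally_asymptotically_stable al (cubic a b c) 0.
Proof.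
move=> al01 c0; have [del d0 fdec] := cubic_decreasing a b c0; split.
- move=> e e0; exists (Num.min e del); first by rewrite lt_min e0.
  move=> T x solx; rewrite subr0 lt_min => /andP[xe xd].
  have [y [cy ry ey yB [gy _]]] := cubic_stable_core al01 d0 fdec solx xd.
  by exists y => // t t0; rewrite subr0 (le_lt_trans (yB t t0)).
- exists del => // T x solx; rewrite subr0 => xd.
  have [y [cy ry ey yB [gy y0]]] := cubic_stable_core al01 d0 fdec solx xd.
  by exists y => //; apply: (cubic_decay al01 d0 fdec) => //; rewrite y0.
Qed.

(** Stability would give a global solution y that starts at some x0 > 0 and
    stays below del.  The barrier w = x0 / 2 + rho p starts below y; at a first
    contact the extremum principle bounds f(w) by the Caputo derivative of w,
    that is by c x0 / 8, whereas f(w) is at least c x0 / 4.  So y stays above w,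
    which is unbounded. *)
Lemma cubic_unstable (R : realType) (al a b c : R) :
  0 < al <= 1 -> 0 < c -> locally_unstable al (cubic a b c) 0.
Proof.
move=> al01 c0 stab; set f := cubic a b c in stab.
have [del d0 fgrow] := cubic_growth a b c0.
have [d d_gt0 Hd] := stab del d0.
pose x0 := Num.min d del / 2.
have md : 0 < Num.min d del by rewrite lt_min d_gt0.
have x00 : 0 < x0 by rewrite divr_gt0.
have [x0d x0del] : x0 < d /\ x0 < del.
  have [? ?] : Num.min d del <= d /\ Num.min d del <= del by rewrite !ge_min !lexx orbT.
  by split; rewrite /x0; lra.
have [z [z0 cz rz ez]] := cubic_solution a b c x0 al01 (ltW d0).
have [T T0 HT] : exists2 T : R, 0 < T & forall s, 0 <= s < T -> `|z s| <= del.
  have gap : 0 < del - x0 by rewrite subr_gt0.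
  have [T /= T0 HT] : \forall s \near (0 : R), `|z 0 - z s| < del - x0.
    by have /cvgrPdist_lt := cz 0; exact.
  exists T => // s /andP[s0 sT].
  have := HT s; rewrite /ball_/= sub0r normrN ger0_norm// => /(_ sT).
  by rewrite z0 ltr_norml => /andP[? ?]; rewrite ler_norml; apply/andP; split; lra.
(* A short time T suffices: stability itself extends the solution. *)
have solz : caputo_solution al f T%:E z.
  apply: caputo_solution_of => // t t0; rewrite lte_fin => tT.
  by apply: ez => // s /andP[s0 st]; apply: HT; rewrite s0 (le_lt_trans st).
have [|y [soly yz] yB] := Hd T%:E z solz; first by rewrite subr0 z0 gtr0_norm.
have y0 : y 0 = x0 by rewrite yz ?z0// lte_fin.
have U0 := caputo_unit_gt0 al01.
(* The Caputo derivative of the barrier is then at most c x0 / 8. *)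
pose rho := c * x0 / (8 * caputo_unit al).
have rho0 : 0 < rho by rewrite divr_gt0 ?mulr_gt0.
have rhoU : rho * caputo_unit al = c * x0 / 8.
  by rewrite /rho; field; rewrite gt_eqF.
pose w t := x0 / 2 + rho * barrier_power al t.
have [cw rw ew] := @growing_barrier _ al rho (x0 / 2) w al01 erefl.
have wge t : x0 / 2 <= w t.
  by rewrite lerDl mulr_ge0 ?barrier_power_ge0// ltW.
have bp0 : barrier_power al 0 = 0 :> R.
  by rewrite /barrier_power power_primitive0//; case/andP : al01.
have wy t : 0 < t -> w t <= y t.
  move=> t0; rewrite leNgt; apply/negP => ywt.
  have [cy _ _] := caputo_solution_upto soly t0 (ltry t).
  have cwt : {within `[0, t], continuous w} by exact: continuous_within_itv.
  have cwy := within_itv_sub cwt cy.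
  have [||t1 [/andP[t10 t1t] wy0 wyle]] := first_hitting (m := 0) (ltW t0) cwy.
  - by rewrite /w bp0 mulr0 addr0 y0; lra.
  - by rewrite subr_ge0 ltW.
  have [_ ry ey] := caputo_solution_upto soly t10 (ltry t1).
  have := caputo_touch al01 t10 (rw t1 t10) ry.
  have H s : 0 < s <= t1 -> w s - y s <= w t1 - y t1.
    by move=> /andP[s0 st]; rewrite wy0; apply: wyle; rewrite (ltW s0).
  move=> /(_ H); rewrite ey ?t10 ?lexx//.
  have yw : y t1 = w t1 by lra.
  have yd := yB t1 (ltW t10); rewrite subr0 yw in yd.
  have wt := wge t1; rewrite gtr0_norm in yd; last lra.
  have := fgrow (w t1); rewrite yw -/f => /(_ ltac:(apply/andP; split; lra)).
  have := ew t1 t10; rewrite rhoU.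
  have : c / 2 * (x0 / 2) <= c / 2 * w t1 by rewrite ler_wpM2l// divr_ge0// ltW.
  have : 0 < c * x0 by rewrite mulr_gt0.
  lra.
have [t0 t00 Ht0] := barrier_power_large (del / rho) al01.
have := yB t0 (ltW t00); rewrite subr0 => yd.
have := wy t0 t00; have := Ht0 t0 (lexx _); rewrite ler_pdivrMr// /w.
have := ler_norm (y t0); lra.
Qed.

(** * Moving an equilibrium to the origin *)

(** The difference quotients are equal, so this also holds where x is not
    differentiable. *)
Lemma derive1_subr (R : realType) (x : R -> R) (q : R) :
  (fun t => x t - q)^`()%classic = x^`()%classic.
Proof.
apply/funext => t; rewrite /derive1.
suff -> : (fun h => h^-1 *: (x (h + t) - q - (x t - q))) =
    (fun h => h^-1 *: (x (h + t) - x t)) by [].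
by apply/funext => h; rewrite opprB addrA subrK.
Qed.

Lemma caputo_solution_shift (R : realType) (al q : R) (f x : R -> R) (T : \bar R) :
  caputo_solution al (fun u => f (u + q)) T (fun t => x t - q) <->
  caputo_solution al f T x.
Proof.
have cap t : caputo al (fun t => x t - q) t = caputo al x t.
  by rewrite /caputo derive1_subr.
have xq : x = (fun t => x t - q) \+ cst q by apply/funext => t /=; rewrite subrK.
split=> -[T0 cx dx ix ex]; split => //; rewrite ?derive1_subr in dx ix *.
- have cxq : {within [set t : R | 0 <= t /\ (t%:E < T)%E],
      continuous (fun t => (x t - q) + q)}.
    by move=> t; apply: cvgD; [exact: cx|exact: cvg_cst].
  by rewrite xq.
- move=> t t0 tT; have [d1 d2] := dx t t0 tT; split => //.
  rewrite xq; apply: (@derivableD _ _ _ (fun t => x t - q) (cst q)); first exact: d1.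
  exact: derivable_cst.
- exact: ix.
- by move=> t t0 tT; rewrite -cap (ex t t0 tT) subrK.
- by move=> t; apply: cvgB; [exact: cx|exact: cvg_cst].
- move=> t t0 tT; have [d1 d2] := dx t t0 tT; split => //.
  apply: (@derivableB _ _ _ x (cst q)); first exact: d1.
  exact: derivable_cst.
- exact: ix.
- by move=> t t0 tT; rewrite cap subrK ex.
Qed.

Lemma global_extension_shift (R : realType) (al q : R) (f x y : R -> R) (T : \bar R) :
  global_extension al (fun u => f (u + q)) T (fun t => x t - q) (fun t => y t - q) <->
  global_extension al f T x y.
Proof.
split=> -[/caputo_solution_shift sy yx]; split => // t t0 tT.
- by have /addIr := yx t t0 tT.
- by rewrite yx.
Qed.

Lemma locally_stable_shift (R : realType) (al q : R) (f : R -> R) :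
  locally_stable al (fun u => f (u + q)) 0 <-> locally_stable al f q.
Proof.
split=> stab e e0; have [d d0 Hd] := stab e e0; exists d => // T x solx xd.
- have [||y gy yB] := Hd T (fun t => x t - q).
  + exact: (caputo_solution_shift al q f x T).2.
  + by rewrite subr0.
  exists (fun t => y t + q).
    apply: (global_extension_shift al q f _ _ T).1.
    by rewrite (_ : (fun t => y t + q - q) = y)//; apply/funext => t; rewrite addrK.
  by move=> t t0; have := yB t t0; rewrite subr0 addrK.
- have [||y gy yB] := Hd T (fun t => x t + q).
  + apply: (caputo_solution_shift al q f _ T).1.
    by rewrite (_ : (fun t => x t + q - q) = x)//; apply/funext => t; rewrite addrK.
  + by rewrite addrK; rewrite subr0 in xd.
  exists (fun t => y t - q).
    rewrite (_ : x = (fun t => x t + q - q)); last by apply/funext => t; rewrite addrK.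
    exact: (global_extension_shift al q f _ _ T).2.
  by move=> t t0; rewrite subr0; exact: yB.
Qed.

Lemma locally_asymptotically_stable_shift (R : realType) (al q : R) (f : R -> R) :
  locally_asymptotically_stable al (fun u => f (u + q)) 0 ->
  locally_asymptotically_stable al f q.
Proof.
move=> [/locally_stable_shift stab [d d0 Hd]]; split => //.
exists d => // T x solx xd; have [||y gy yB] := Hd T (fun t => x t - q).
- exact: (caputo_solution_shift al q f x T).2.
- by rewrite subr0.
exists (fun t => y t + q).
  apply: (global_extension_shift al q f _ _ T).1.
  by rewrite (_ : (fun t => y t + q - q) = y)//; apply/funext => t; rewrite addrK.
by rewrite -[X in _ --> X]add0r; apply: cvgD => //; exact: cvg_cst.
Qed.

Lemma cubic_shift (R : realType) (a b c q : R) : cubic a b c q = 0 ->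
  (fun u => cubic a b c (u + q)) = cubic a (3 * a * q + b) (cubic_deriv a b c q).
Proof.
move=> fq; apply/funext => u; rewrite -[LHS]subr0 -fq /cubic /cubic_deriv; ring.
Qed.

Lemma cubic_linearized_stable (R : realType) (al a b c q : R) : 0 < al <= 1 ->
  equilibrium (cubic a b c) q -> cubic_deriv a b c q < 0 ->
  locally_asymptotically_stable al (cubic a b c) q.
Proof.
move=> al01 fq dq; apply: locally_asymptotically_stable_shift.
by rewrite cubic_shift//; exact: cubic_asymptotically_stable.
Qed.

Lemma cubic_linearized_unstable (R : realType) (al a b c q : R) : 0 < al <= 1 ->
  equilibrium (cubic a b c) q -> 0 < cubic_deriv a b c q ->
  locally_unstable al (cubic a b c) q.
Proof.
move=> al01 fq dq /locally_stable_shift; rewrite cubic_shift//.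
exact: cubic_unstable.
Qed.

(** With s = 2 a q + b, the equation for q reads a q^2 + b q + c = 0, and f'(q)
    = q (2 a q + b) = s q. *)
Lemma cubic_deriv_root (R : realType) (a b c s q : R) : a != 0 ->
  s ^+ 2 = b ^+ 2 - 4 * a * c -> q = (- b + s) / (2 * a) ->
  equilibrium (cubic a b c) q /\ cubic_deriv a b c q = s * ((s - b) / (2 * a)).
Proof.
move=> a0 s2 qE.
have sE : s = 2 * a * q + b by rewrite qE; field.
have root : a * q ^+ 2 + b * q + c = 0.
  have : 4 * a * (a * q ^+ 2 + b * q + c) = 0.
    rewrite sE in s2.
    have -> : 4 * a * (a * q ^+ 2 + b * q + c) =
      (2 * a * q + b) ^+ 2 - (b ^+ 2 - 4 * a * c) by ring.
    by rewrite s2 subrr.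
  by move=> /eqP; rewrite !mulf_eq0 pnatr_eq0/= (negbTE a0)/= => /eqP.
split.
  rewrite /equilibrium /cubic.
  have -> : a * q ^+ 3 + b * q ^+ 2 + c * q = (a * q ^+ 2 + b * q + c) * q by ring.
  by rewrite root mul0r.
rewrite (_ : (s - b) / (2 * a) = q); last by rewrite qE addrC.
have -> : s * q = cubic_deriv a b c q - (a * q ^+ 2 + b * q + c).
  by rewrite sE /cubic_deriv; ring.
by rewrite root subr0.
Qed.

Theorem mainTheorem2 (R : realType) (alpha a b c : R)
    (alpha_gt0 : 0 < alpha) (alpha_le1 : alpha <= 1) :
  let f := cubic a b c in
  let asym_stable := locally_asymptotically_stable alpha f in
  let unstable := locally_unstable alpha f in
  (a != 0 ->
     (equilibrium f 0 /\ (0 < c -> unstable 0) /\ (c < 0 -> asym_stable 0)) /\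
     (0 < b ^+ 2 - 4 * a * c ->
        let r := Num.sqrt (b ^+ 2 - 4 * a * c) in
        let x2 := (- b + r) / (2 * a) in
        let x3 := (- b - r) / (2 * a) in
        (equilibrium f x2 /\ equilibrium f x3) /\
        ((0 < a -> (b < r -> unstable x2) /\ (r < b -> asym_stable x2)) /\
         (a < 0 -> (b < r -> asym_stable x2) /\ (r < b -> unstable x2))) /\
        ((0 < a -> (b < - r -> asym_stable x3) /\ (- r < b -> unstable x3)) /\
         (a < 0 -> (b < - r -> unstable x3) /\ (- r < b -> asym_stable x3))))) /\
  (a = 0 -> b != 0 -> c != 0 ->
     let x2 := - (c / b) in
     (forall x : R, equilibrium f x <-> x = 0 \/ x = x2) /\
     (0 < c -> unstable 0 /\ asym_stable x2) /\
     (c < 0 -> asym_stable 0 /\ unstable x2)).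
Proof.
move=> f asym_stable unstable.
have al01 : 0 < alpha <= 1 by rewrite alpha_gt0.
have st q : equilibrium f q -> cubic_deriv a b c q < 0 -> asym_stable q.
  exact: cubic_linearized_stable.
have un q : equilibrium f q -> 0 < cubic_deriv a b c q -> unstable q.
  exact: cubic_linearized_unstable.
split.
- move=> a0; split.
    split; first exact: cubic0.
    by split=> c0; [exact: cubic_unstable|exact: cubic_asymptotically_stable].
  move=> disc r x2 x3.
  have r0 : 0 < r by rewrite sqrtr_gt0.
  have r2 : r ^+ 2 = b ^+ 2 - 4 * a * c by rewrite sqr_sqrtr// ltW.
  have [e2 D2] := cubic_deriv_root a0 r2 (erefl : x2 = (- b + r) / (2 * a)).
  have Nr2 : (- r) ^+ 2 = b ^+ 2 - 4 * a * c by rewrite sqrrN.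
  have [e3 D3] := cubic_deriv_root a0 Nr2 (erefl : x3 = (- b + - r) / (2 * a)).
  have pos (u v : R) : 0 < u -> 0 < v -> 0 < u / (2 * v).
    by move=> u0 v0; rewrite divr_gt0 ?mulr_gt0.
  have flip (u v : R) : u / (2 * v) = - (u / (2 * - v)) by rewrite mulrN invrN mulrN opprK.
  split => //; split; split=> sa; split=> h.
  + by apply: un => //; rewrite D2 mulr_gt0// pos// subr_gt0.
  + by apply: st => //; rewrite D2 pmulr_rlt0// -opprB mulNr oppr_lt0 pos// subr_gt0.
  + by apply: st => //; rewrite D2 pmulr_rlt0// flip oppr_lt0 pos ?subr_gt0// oppr_gt0.
  + apply: un => //; rewrite D2 mulr_gt0// flip -opprB mulNr opprK.
    by rewrite pos ?subr_gt0// oppr_gt0.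
  + apply: st => //; rewrite D3 mulNr oppr_lt0 mulr_gt0// pos//; lra.
  + apply: un => //; rewrite D3 mulNr -mulrN mulr_gt0// -mulNr pos//; lra.
  + by apply: un => //; rewrite D3 mulNr -mulrN mulr_gt0// flip opprK pos ?oppr_gt0//; lra.
  + apply: st => //; rewrite D3 mulNr oppr_lt0 mulr_gt0// flip -mulNr pos ?oppr_gt0//; lra.
- move=> a0 b0 c0 x2.
  have eqP' x : equilibrium f x <-> x = 0 \/ x = x2.
    rewrite /equilibrium /f /cubic a0 mul0r add0r.
    have -> : b * x ^+ 2 + c * x = b * x * (x - x2).
      by rewrite /x2; field.
    split.
      move=> /eqP; rewrite !mulf_eq0 (negbTE b0)/= subr_eq0 => /orP[]/eqP; by [left|right].
    by case=> ->; rewrite ?subrr ?mulr0 ?mul0r.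
  have e2 : equilibrium f x2 by apply/eqP'; right.
  have D2 : cubic_deriv a b c x2 = - c.
    by rewrite /cubic_deriv a0 /x2; field.
  split => //; split=> hc; split.
  + exact: cubic_unstable.
  + by apply: st => //; rewrite D2 oppr_lt0.
  + exact: cubic_asymptotically_stable.
  + by apply: un => //; rewrite D2 oppr_gt0.
Qed.
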